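(* Let $d>1$ and let $\rho$ be a probability density on $[0,\infty)$ satisfying $\lim_{x\to 0^+}\rho(x)/(dx^{d-1})=1$ and having finite $r$-th moment for some $r>2d/(d-1)$. Let $C_{n,n}^\rho$ be the total cost of the stable matching in $K_{n,n}^\rho$. Then, as $n\to\infty$, $$\frac{\mathbb{E}\,C_{n,n}^\rho}{n^{1-1/d}}\longrightarrow\frac{\pi}{d\sin(\pi/d)}$$ and $$\frac{C_{n,n}^\rho}{n^{1-1/d}}\longrightarrow\frac{\pi}{d\sin(\pi/d)}\quad\text{in probability}.$$
   Context: $K_{n,n}^\rho$ is the complete bipartite graph with vertex sets $V_n,V_n'$, each of size $n$, whose edges $e=(v,v')$, $v\in V_n$, $v'\in V_n'$, carry i.i.d. non-negative costs $\omega(e)$ with density $\rho$. A matching is a set of pairwise non-adjacent edges. The matching cost of a vertex is the cost of the edge of the matching incident to it (and $\infty$ if it is unmatched). A matching is stable if for every pair $v\in V_n$, $v'\in V_n'$, either $v$ and $v'$ are matched to each other or at least one of them has matching cost smaller than $\omega(v,v')$. Almost surely there is a unique stable matching; it is perfect and is obtained by the greedy algorithm which repeatedly adds the cheapest edge among those with both endpoints still unmatched. Its total cost $C_{n,n}^\rho$ is the sum of the costs of its $n$ edges. The $r$-th moment of $\rho$ is $\int_0^\infty x^r\rho(x)\,dx$. *)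

(* Defs.v *)
From HB Require Import structures.
From mathcomp Require Import all_boot all_order all_algebra.
From mathcomp Require Import all_classical all_reals all_analysis.

Set Implicit Arguments.
Unset Strict Implicit.
Unset Printing Implicit Defensive.

Import Order.TTheory GRing.Theory Num.Theory.
Import numFieldNormedType.Exports.

Local Open Scope classical_set_scope.
Local Open Scope ring_scope.

(* The edge {v, v'} of K_{n,n} is the pair (v, v'): the first component is a
   vertex of V_n and the second one a vertex of V_n'. *)
Definition edge (n : nat) : finType := ('I_n * 'I_n)%type.

Section StableMatching.
Context {R : realType} {n : nat}.
Implicit Types (w : edge n -> R) (M : {set edge n}).

Definition adjacent (e f : edge n) : Prop :=
  e <> f /\ (e.1 = f.1 \/ e.2 = f.2).

Definition is_matching M : Prop :=
  forall e f, e \in M -> f \in M -> ~ adjacent e f.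

(* In a matching at most one edge is incident to a given vertex, so each of
   these minima is over at most one edge; the empty minimum is +oo. *)
Definition matching_cost_l w M (v : 'I_n) : \bar R :=
  \big[Order.min/+oo%E]_(e in M | e.1 == v) (w e)%:E.

Definition matching_cost_r w M (v' : 'I_n) : \bar R :=
  \big[Order.min/+oo%E]_(e in M | e.2 == v') (w e)%:E.

Definition is_stable_matching w M : Prop :=
  is_matching M /\
  forall v v' : 'I_n,
    [\/ (v, v') \in M,
        (matching_cost_l w M v < (w (v, v'))%:E)%E |
        (matching_cost_r w M v' < (w (v, v'))%:E)%E].

(* When the stable matching of w is not unique (a null event for the costs
   considered here) this is an arbitrary stable matching, and it is the empty
   set if there is none. *)
Definition stable_matching w : {set edge n} :=
  xget finset.set0 [set M | is_stable_matching w M].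

Definition stable_cost w : R := \sum_(e in stable_matching w) w e.

End StableMatching.

Section Probability.
Context {R : realType}.

Definition is_density_nonneg (rho : R -> R) : Prop :=
  [/\ measurable_fun (`[0, +oo[ : set R) rho,
      forall x, 0 <= x -> 0 <= rho x &
      (\int[lebesgue_measure]_(x in `[0%R, +oo[) (rho x)%:E = 1)%E].

(* Only the values of rho on [0, +oo[ matter; in particular the law of X gives
   no mass to the negative reals. *)
Definition has_density_nonneg {disp : measure_display}
    {T : measurableType disp} (P : probability T R) (X : {RV P >-> R})
    (rho : R -> R) : Prop :=
  forall A : set R, measurable A ->
    (distribution P X A =
     \int[lebesgue_measure]_(x in A `&` `[0%R, +oo[) (rho x)%:E)%E.

Definition mutually_independent {disp : measure_display}
    {T : measurableType disp} (P : probability T R) {I : finType}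
    (X : I -> {RV P >-> R}) : Prop :=
  forall (J : {set I}) (A : I -> set R), (forall i, measurable (A i)) ->
    (P (\bigcap_(i in [set` J]) (X i @^-1` A i)) =
     \prod_(i in J) P (X i @^-1` A i))%E.

Definition cvg_in_probability {disp : nat -> measure_display}
    {T : forall n, measurableType (disp n)} (P : forall n, probability (T n) R)
    (X : forall n, T n -> R) (c : R) : Prop :=
  forall eps : R, 0 < eps ->
    P n [set t | eps < `|X n t - c|] @[n --> \oo] --> 0%E.

End Probability.

Arguments has_density_nonneg {R disp T} P X rho.
Arguments mutually_independent {R disp T} P {I} X.
Arguments cvg_in_probability {R disp T} P X c.

(* Main.v *)
Require Import Defs.
From mathcomp Require Import all_boot all_order all_algebra.
From mathcomp Require Import all_classical all_reals all_analysis.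
From mathcomp Require Import measurable_realfun.
From mathcomp Require Import ring lra.
Set Implicit Arguments.
Unset Strict Implicit.
Unset Printing Implicit Defensive.
Import Order.TTheory GRing.Theory Num.Theory.
Import numFieldNormedType.Exports.
Local Open Scope classical_set_scope.
Local Open Scope ring_scope.

(** Almost surely the costs are distinct and positive ([ae_generic]), and then
    the stable matching is the greedy one ([stable_cost_matched]).  Let [U x] be
    the number of vertices on each side that the greedy algorithm has left
    unmatched after examining the edges of cost at most [x]; in the code it is
    [nfree].  Each edge of the final matching is counted by [U] up to its own
    cost, so the total cost is the integral of [U] over the positive half-line
    ([cost_integral]).

    The process [U] is governed by the fact that exactly [U^2] edges are free,
    that is, have both endpoints unmatched ([card_free]), and that the cost of a
    free edge is, given the other costs, only known to exceed [x].  So if [F] is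
    the distribution function of the costs, then for every function [f]

      d E f(U) = E (U^2 (f(U - 1) - f(U))) dF / (1 - F),

    up to an error of second order in the increment of [F] ([generator]); such
    errors sum up to nothing ([quadratic_error]).  For [f(k) = k] and by Jensen's
    inequality, [E U <= 1 / (1/n + F)] ([mean_free_upper]); for
    [f(k) = 1/(k + 1)], [E (1/(U + 1)) <= 1/(n + 1) + F / (1 - F x0)] up to [x0]
    ([mean_inv_upper]).  Near 0, where [F x] is close to [x^d], these
    two bounds are almost reciprocal to each other, which is possible
    only if [U x] is concentrated around [c x = n / (1 + n x^d)]
    ([mean_dist]).  Beyond a fixed [x0], the mean of [U] is bounded uniformly in
    [n] and decreases at least like [1 - F] ([mean_free_tail]), which the moment
    assumption makes integrable ([dcdf_tail]).  Integrating these errors, the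
    cost differs from the integral of [c] up to [x0] by an arbitrarily small
    multiple of that integral plus a constant, in mean ([cost_near_hill]).

    The substitution [t = n^(1/d) x] turns the integral of [c] into [n^(1 - 1/d)]
    times the integral of [1 / (1 + t^d)] up to [x0 n^(1/d)]
    ([prim_hill_scale]), so the rescaled cost converges in L^1 to the integral
    of [1 / (1 + t^d)] over the positive half-line ([stable_cost_L1]), hence in
    mean and in probability.

    That integral is [(pi/d) / sin (pi/d)] ([prim_hill_cvg]).  With
    [t = e^(s/d)] and [a = 1/d] it becomes half the integral of
    [cosh (a s) / cosh (s/2)^2] over the positive half-line.  Raising the exponent
    2 by integration by parts produces the factors [1 - a^2/k^2] of Euler's
    product, just as raising the power of the cosine does in the integral of
    [cos (2 a x) (cos x)^(2 n)] over a quarter period, which starts from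
    [sin (pi a) / (2 a)] ([coshint_rec], [cosint_rec]).  The two products
    cancel ([coshint2_limit]). *)


(** * Integrals of continuous functions from 0 *)
Section Primitive.
Context {R : realType}.
Notation mu := (@lebesgue_measure R).
Implicit Types f g W : R -> R.

Definition prim f (x : R) : R := \int[mu]_(t in `[0, x]) f t.

Lemma derivable_continuous f : (forall y : R, derivable f y 1) -> continuous f.
Proof. by move=> df y; apply/differentiable_continuous/derivable1_diffP. Qed.

Lemma continuous_integrable f (x : R) :
  continuous f -> mu.-integrable `[0, x] (EFin \o f).
Proof.
move=> cf; apply: continuous_compact_integrable; first exact: segment_compact.
exact: continuous_subspaceT.
Qed.

Lemma prim0 f : prim f 0 = 0.
Proof. by rewrite /prim set_itv1 Rintegral_set1. Qed.

Lemma is_derive_prim f (x : R) : continuous f -> 0 < x -> is_derive x 1 (prim f) (f x).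
Proof.
move=> cf x0; have := @continuous_FTC1_closed R f 0 x (x + 1).
have -> : x < x + 1 by rewrite ltrDl.
move=> /(_ isT (continuous_integrable _ cf) x0 (cf x))[d1 d2].
by rewrite derive1E in d2; exact: DeriveDef d1 d2.
Qed.

(** Right-continuity of [W] at 0 stands in for differentiability there, so that
    antiderivatives such as a power of real exponent are covered. *)
Lemma primE_gt0 f W (x : R) : continuous f ->
  (forall y : R, 0 < y -> is_derive y 1 W (f y)) -> W y @[y --> 0^'+] --> W 0 ->
  0 <= x -> prim f x = W x - W 0.
Proof.
move=> cf dW W0; rewrite le_eqVlt => /predU1P[<-|x0]; first by rewrite prim0 subrr.
have dW1 (y : R) : 0 < y -> derivable W y 1.
  by move=> y0; exact: (@ex_derive _ _ _ _ _ _ _ (dW y y0)).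
rewrite /prim /Rintegral (@continuous_FTC2 R f W)//.
- exact: continuous_subspaceT.
- split=> //; first by move=> y; rewrite in_itv /= => /andP[y0 _]; exact: dW1.
  apply/cvg_at_left_filter/differentiable_continuous/derivable1_diffP.
  exact: dW1.
- move=> y; rewrite in_itv /= => /andP[y0 _]; rewrite derive1E.
  by have dWy := dW y y0; rewrite derive_val.
Qed.

Lemma primE f W (x : R) : continuous f -> (forall y : R, is_derive y 1 W (f y)) ->
  0 <= x -> prim f x = W x - W 0.
Proof.
move=> cf dW; apply: primE_gt0 => //.
apply/cvg_at_right_filter/differentiable_continuous/derivable1_diffP.
exact: (@ex_derive _ _ _ _ _ _ _ (dW 0)).
Qed.

Lemma le_prim f g (x : R) : continuous f -> continuous g ->
  (forall t, 0 <= t <= x -> f t <= g t) -> prim f x <= prim g x.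
Proof.
move=> cf cg fg; apply: le_Rintegral => //; try exact: continuous_integrable.
Qed.

Lemma primD f g (x : R) : continuous f -> continuous g ->
  prim (fun t => f t + g t) x = prim f x + prim g x.
Proof. by move=> cf cg; apply: RintegralD => //; exact: continuous_integrable. Qed.

Lemma primZ f k x : continuous f -> prim (fun t => k * f t) x = k * prim f x.
Proof. by move=> cf; apply: RintegralZl => //; exact: continuous_integrable. Qed.

Lemma eq_prim f g x : f =1 g -> prim f x = prim g x.
Proof. by move=> fg; apply: eq_Rintegral => t _. Qed.

Lemma prim_ge0 f x : (forall t, 0 <= f t) -> 0 <= prim f x.
Proof. by move=> f0; apply: Rintegral_ge0. Qed.

Lemma le_prim_x f (x y : R) : continuous f -> (forall t, 0 <= f t) -> x <= y ->
  prim f x <= prim f y.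
Proof.
move=> cf f0 xy; case: (ltP x 0) => x0.
  rewrite [prim f x]/prim set_itv_ge ?bnd_simp -?ltNge //.
  by rewrite Rintegral_set0 prim_ge0.
rewrite -subr_ge0 /prim.
rewrite (@Rintegral_itvB _ f (BLeft 0) (BRight y) x) //.
- by apply: Rintegral_ge0.
- exact: continuous_integrable.
Qed.

End Primitive.
(** * The product formula for the sine *)
Section SineProduct.
Context {R : realType}.

#[global] Instance is_derive_pow (g : R -> R) n (x dg : R) : is_derive x 1 g dg ->
  is_derive x 1 (fun y => g y ^+ n) (n%:R * g x ^+ n.-1 * dg).
Proof. by move=> dgx; have := @is_deriveX R R g n x 1 dg dgx; rewrite exprfctE. Qed.

Definition cosint (n : nat) (p : R) : R :=
  prim (fun x => cos (p * x) * cos x ^+ n) (pi / 2).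

Lemma continuous_cosint n (p : R) : continuous (fun x : R => cos (p * x) * cos x ^+ n).
Proof.
apply: derivable_continuous => y.
have [//] : is_derive y (1:R) (fun x : R => cos (p * x) * cos x ^+ n)
  (cos (p * y) *: (n%:R * cos y ^+ n.-1 * (- sin y)) + cos y ^+ n *: (- sin (p * y) * (p *: 1))).
by apply: trigger_derive; rewrite /GRing.scale /= ?(mulr0, addr0, mulr1).
Qed.

(** Integration by parts: the difference of the two integrands is the derivative
    of [W] below, which vanishes at 0 and at pi/2. *)
Lemma cosint_rec n (p : R) :
  (n.+2%:R ^+ 2 - p ^+ 2) * cosint n.+2 p = n.+2%:R * n.+1%:R * cosint n p.
Proof.
pose W (x : R) : R := p * sin (p * x) * cos x ^+ n.+2
            - n.+2%:R * cos (p * x) * cos x ^+ n.+1 * sin x.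
pose f (x : R) : R := (p ^+ 2 - n.+2%:R ^+ 2) * (cos (p * x) * cos x ^+ n.+2) +
            n.+2%:R * n.+1%:R * (cos (p * x) * cos x ^+ n).
have dW (y : R) : is_derive y 1 W (f y).
  apply: trigger_derive; rewrite /f /GRing.scale /= ?(mulr0, addr0, mulr1).
  rewrite [cos y ^+ n.+2]exprSr [cos y ^+ n.+1]exprSr -(natr1 n.+1).
  have := sin2cos2 y; set s := sin y; set c := cos y => hs.
  transitivity (p ^+ 2 * cos (p * y) * (c ^+ n * c * c) - (n.+1%:R + 1) * cos (p * y) * (c ^+ n * c * c)
    + (n.+1%:R + 1) * n.+1%:R * cos (p * y) * c ^+ n * s ^+ 2); first by ring.
  by rewrite hs; ring.
have cf k := @continuous_cosint k p.
have ckf k (c : R) : continuous (fun x : R => c * (cos (p * x) * cos x ^+ k)).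
  by move=> y; apply: cvgM; [exact: cvg_cst|exact: cf].
have cff : continuous f by move=> y; apply: cvgD; exact: ckf.
have pi2 : 0 <= pi / 2 :> R by rewrite divr_ge0 // pi_ge0.
have := primE cff dW pi2.
rewrite /f primD //.
have -> : W (pi / 2) - W 0 = 0.
  by rewrite /W cos_pihalf !(exprS, mul0r, mulr0, sin0); ring.
rewrite !primZ // -/(cosint n p) -/(cosint n.+2 p) => h.
by apply: subr0_eq; rewrite -oppr0 -h; ring.
Qed.

Lemma cosint_recV (m : nat) (a : R) :
  (1 - a ^+ 2 / m.+1%:R ^+ 2) * cosint m.+1.*2 (2 * a) =
  m.*2.+1%:R / m.*2.+2%:R * cosint m.*2 (2 * a).
Proof.
have h := cosint_rec m.*2 (2 * a).
have h1 : m.*2.+2%:R = 2 * m.+1%:R :> R by rewrite -doubleS -mul2n natrM.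
have m0 : m.+1%:R != 0 :> R by rewrite pnatr_eq0.
have m0' : m.*2.+2%:R != 0 :> R by rewrite pnatr_eq0.
apply: (mulfI (mulf_neq0 m0' m0')).
transitivity ((m.*2.+2%:R ^+ 2 - (2 * a) ^+ 2) * cosint m.+1.*2 (2 * a)).
  by rewrite h1; field.
by rewrite doubleS h; field.
Qed.

Lemma cosint00 : cosint 0 0 = pi / 2.
Proof.
have pi2 : 0 <= pi / 2 :> R by rewrite divr_ge0 // pi_ge0.
rewrite /cosint (@primE _ _ (fun x => x) _ _ _ pi2) ?subr0 //.
  exact: continuous_cosint.
by move=> y; rewrite mul0r cos0 mul1r expr0; exact: is_derive_id.
Qed.

Lemma cosint0 (a : R) : 0 < a -> cosint 0 (2 * a) = sin (pi * a) / (2 * a).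
Proof.
move=> a0; have pi2 : 0 <= pi / 2 :> R by rewrite divr_ge0 // pi_ge0.
rewrite /cosint (@primE _ _ (fun x => (2 * a)^-1 * sin (2 * a * x)) _ _ _ pi2) //.
- rewrite mulr0 sin0 mulr0 subr0 mulrC; congr (sin _ / _); by field.
- exact: continuous_cosint.
move=> y; apply: trigger_derive; rewrite /GRing.scale /= expr0 ?(mulr0, addr0, mulr1).
by field; rewrite gt_eqF.
Qed.

Lemma cosint_prod (a : R) n :
  (\prod_(k < n) (1 - a ^+ 2 / k.+1%:R ^+ 2)) * cosint n.*2 (2 * a) =
  (\prod_(k < n) (k.*2.+1%:R / k.*2.+2%:R)) * cosint 0 (2 * a).
Proof.
elim: n => [|n IH]; first by rewrite !big_ord0.
rewrite !big_ord_recr /= -mulrA cosint_recV mulrCA IH; ring.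
Qed.

(** Frequency 2 is explicit because [1 + cos (2 t) = 2 (cos t)^2]. *)
Lemma cosint_half (n : nat) : cosint n.*2 2 = n%:R / n.+1%:R * cosint n.*2 0.
Proof.
have e : cosint n.*2 2 + cosint n.*2 0 = 2 * cosint n.+1.*2 0.
  rewrite /cosint -primZ -?primD; try exact: continuous_cosint.
  by apply: eq_prim => t; rewrite mulr_natl cos_mulr2n mul0r cos0 doubleS !exprS; ring.
have := cosint_recV n 0.
rewrite mulr0 expr0n /= mul0r subr0 mul1r => r.
have -> : cosint n.*2 2 = 2 * cosint n.+1.*2 0 - cosint n.*2 0 by rewrite -e; ring.
rewrite r; have -> : n.*2.+2%:R = 2 * n.+1%:R :> R by rewrite -doubleS -mul2n natrM.
rewrite -[n.*2.+1]addn1 natrD -mul2n natrM -[n.+1]addn1 natrD.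
by field; rewrite natr1 pnatr_eq0.
Qed.

(** The cosine decreases from 0 to pi, so the integral at frequency [2 a] lies
    between those at frequencies 2 and 0. *)
Lemma cosint_bounds (n : nat) (a : R) : 0 < a < 1 ->
  n%:R / n.+1%:R * cosint n.*2 0 <= cosint n.*2 (2 * a) <= cosint n.*2 0.
Proof.
move=> /andP[a0 a1]; rewrite -cosint_half.
have c2 (t : R) : 0 <= cos t ^+ n.*2 by rewrite -mul2n exprM exprn_ge0 // sqr_ge0.
apply/andP; split; apply: le_prim; try exact: continuous_cosint => //;
  move=> t /andP[t0 t1]; apply: ler_wpM2r => //.
  have tpi : t * 2 <= pi by rewrite -ler_pdivlMr.
  have a2 : 0 <= 2 * a * t by rewrite !mulr_ge0 // ltW.
  have at_ : 2 * a * t <= 2 * t by rewrite ler_wpM2r // ler_piMr // ltW.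
  have [->//|h] := eqVneq (2 * a * t) (2 * t).
  rewrite ltW // ltr_cos ?in_itv /= ?a2 ?(le_trans at_) ?mulr_ge0 1?mulrC //.
  by rewrite -[t * _]mulrC lt_neqAle h.
by rewrite mul0r cos0 cos_le1.
Qed.

Definition euler_prod (n : nat) (a : R) : R :=
  \prod_(k < n) (1 - a ^+ 2 / k.+1%:R ^+ 2).

(** Euler's product with an explicit error.  Iterating [cosint_recV] expresses
    the integral with the [2 n]-th power of the cosine through the elementary one with
    power 0, at the price of [n] factors of the product; dividing by the same
    identity at [a = 0], [cosint_bounds] turns into bounds on the sine. *)
Lemma sin_prod_bounds (n : nat) (a : R) : 0 < a < 1 ->
  n%:R / n.+1%:R * (euler_prod n a * (pi * a)) <= sin (pi * a)
    <= euler_prod n a * (pi * a).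
Proof.
rewrite /euler_prod; set p := \prod_(k < n) _ => a01; have /andP[lo hi] := cosint_bounds n a01.
have h := cosint_prod a n; have h0 := cosint_prod 0 n.
have e : \prod_(k < n) (1 - (0 : R) ^+ 2 / k.+1%:R ^+ 2) = 1.
  by apply: big1 => i _; rewrite expr0n /= mul0r subr0.
rewrite e mul1r mulr0 cosint00 in h0.
rewrite -/p in h; set c := \prod_(k < n) _ in h h0.
have c0 : 0 < c by apply: prodr_gt0 => i _; rewrite divr_gt0.
case/andP: a01 => a0 a1.
have p0 : 0 < p.
  apply: prodr_gt0 => i _; rewrite subr_gt0 ltr_pdivrMr ?exprn_gt0 // mul1r.
  by rewrite ltrXn2r // ?nnegrE ?ltW //= (lt_le_trans a1) // ler1n.
rewrite cosint0 // in h.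
have -> : sin (pi * a) = 2 * a / c * (p * cosint n.*2 (2 * a)).
  by rewrite h; field; rewrite !gt_eqF.
have -> : p * (pi * a) = 2 * a / c * (p * cosint n.*2 0).
  by rewrite h0; field; rewrite gt_eqF.
have k0 : 0 <= 2 * a / c * p by rewrite !mulr_ge0 ?invr_ge0 ?ltW.
rewrite mulrCA (mulrCA (n%:R / _) p) !(mulrA (2 * a / c)).
by apply/andP; split; exact: ler_wpM2l.
Qed.

End SineProduct.
(** * The integral of [1 / (1 + t^d)] *)
Section Hyperbolic.
Context {R : realType}.

Definition ch (x : R) : R := (expR x + expR (- x)) / 2.
Definition sh (x : R) : R := (expR x - expR (- x)) / 2.
(** The hyperbolic secant of [x / 2]: its square is [4 e^x / (1 + e^x)^2], the
    factor that the substitution [t = e^(x/d)] and an integration by parts produce from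
    [1 / (1 + t^d)]. *)
Definition sech (x : R) : R := (ch (x / 2))^-1.

Lemma ch_gt0 x : 0 < ch x.
Proof. by rewrite divr_gt0 // addr_gt0 // expR_gt0. Qed.

Lemma ch2Bsh2 x : ch x ^+ 2 = 1 + sh x ^+ 2.
Proof.
rewrite /ch /sh; have := expRxMexpNx_1 x; set u := expR x; set v := expR (- x) => uv.
transitivity (u * v + ((u - v) / 2) ^+ 2); last by rewrite uv.
by field.
Qed.

Lemma ch_double x : ch x = 2 * ch (x / 2) ^+ 2 - 1.
Proof.
rewrite /ch; have := expRxMexpNx_1 (x / 2).
have -> : expR x = expR (x / 2) ^+ 2 by rewrite expr2 -expRD -splitr.
have -> : expR (- x) = expR (- (x / 2)) ^+ 2 by rewrite expr2 -expRD -opprD -splitr.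
set u := expR (x / 2); set v := expR (- (x / 2)) => uv.
transitivity (2 * ((u + v) / 2) ^+ 2 - u * v); last by rewrite uv.
by field.
Qed.

Lemma norm_sh_le x : `|sh x| <= ch x.
Proof.
have c0 := ltW (ch_gt0 x).
by rewrite -(@ler_pXn2r _ 2) ?nnegrE // real_normK ?num_real // ch2Bsh2 lerDr.
Qed.

Lemma sech_gt0 x : 0 < sech x.
Proof. by rewrite invr_gt0 ch_gt0. Qed.

#[global] Instance is_derive_ch (g : R -> R) (x dg : R) : is_derive x 1 g dg ->
  is_derive x 1 (fun y => ch (g y)) (sh (g x) * dg).
Proof.
move=> dgx; apply: trigger_derive; rewrite /sh /GRing.scale /= ?(mulr0, addr0).
by ring.
Qed.

#[global] Instance is_derive_sh (g : R -> R) (x dg : R) : is_derive x 1 g dg ->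
  is_derive x 1 (fun y => sh (g y)) (ch (g x) * dg).
Proof.
move=> dgx; apply: trigger_derive; rewrite /ch /GRing.scale /= ?(mulr0, addr0).
by ring.
Qed.

#[global] Instance is_derive_sech (x : R) :
  is_derive x 1 sech (- (sh (x / 2) * sech x ^+ 2 / 2)).
Proof.
have h0 : ch (x / 2) != 0 by rewrite gt_eqF // ch_gt0.
apply: trigger_derive; first exact: is_deriveV.
by rewrite /sech /GRing.scale /= ?(mulr0, addr0, mulr1); field.
Qed.

Definition coshint (m : nat) (a X : R) : R :=
  prim (fun t => ch (a * t) * sech t ^+ m) X.

Lemma continuous_coshint m (a : R) : continuous (fun t : R => ch (a * t) * sech t ^+ m).
Proof.
apply: derivable_continuous => y.
have [//] : is_derive y (1:R) (fun t : R => ch (a * t) * sech t ^+ m)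
  (ch (a * y) * (m%:R * sech y ^+ m.-1 * (- (sh (y / 2) * sech y ^+ 2 / 2)))
   + sech y ^+ m * (sh (a * y) * a)).
by apply: trigger_derive; rewrite /GRing.scale /= ?(mulr0, addr0, mulr1).
Qed.

(** The boundary term of the integration by parts in [coshint_rec]. *)
Definition coshint_bd (m : nat) (a x : R) : R :=
  a * sh (a * x) * sech x ^+ m
  + m%:R / 2 * ch (a * x) * sech x ^+ m.+1 * sh (x / 2).

(** The hyperbolic analogue of [cosint_rec]: the combination of the integrands is
    the derivative of [coshint_bd m a], which vanishes at 0. *)
Lemma coshint_rec m (a X : R) : 0 <= X ->
  (a ^+ 2 - m%:R ^+ 2 / 4) * coshint m a X
  + m%:R * m.+1%:R / 4 * coshint m.+2 a X = coshint_bd m a X.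
Proof.
move=> X0; pose f (x : R) : R :=
  (a ^+ 2 - m%:R ^+ 2 / 4) * (ch (a * x) * sech x ^+ m)
  + m%:R * m.+1%:R / 4 * (ch (a * x) * sech x ^+ m.+2).
have dW (y : R) : is_derive y 1 (coshint_bd m a) (f y).
  apply: trigger_derive; rewrite /f /GRing.scale /= ?(mulr0, addr0, mulr1).
  have h1 : sech y ^+ 2 * sh (y / 2) ^+ 2 = 1 - sech y ^+ 2.
    have := ch2Bsh2 (y / 2); rewrite /sech => e.
    have -> : sh (y / 2) ^+ 2 = ch (y / 2) ^+ 2 - 1 by rewrite e; ring.
    by field; rewrite gt_eqF // ch_gt0.
  have h2 : sech y * ch (y / 2) = 1 by rewrite mulVf // gt_eqF // ch_gt0.
  have -> : m%:R * sech y ^+ m.-1 * - (sh (y / 2) * sech y ^+ 2 / 2)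
            = - (m%:R / 2 * sh (y / 2) * (sech y * sech y ^+ m)).
    by case: m {f} => [|m] /=; [field | rewrite [sech y ^+ m.+1]exprS; field].
  rewrite !exprS -(natr1 m) add0r.
  set H := sech y ^+ m; set h := sech y in h1 h2 *; set s := sh (y / 2) in h1 h2 *.
  set c := ch (y / 2) in h2 *; set u := ch _; set v := sh _.
  transitivity (a ^+ 2 * u * H + m%:R / 4 * u * H * (h * c)
    - m%:R * (m%:R + 1) / 4 * u * H * (h ^+ 2 * s ^+ 2)); first by field.
  by rewrite h1 h2; field.
have cf k := @continuous_coshint k a.
have ckf k (c : R) : continuous (fun x : R => c * (ch (a * x) * sech x ^+ k)).
  by move=> y; apply: cvgM; [exact: cvg_cst|exact: cf].
have cff : continuous f by move=> y; apply: cvgD; exact: ckf.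
have := primE cff dW X0.
rewrite /f primD // !primZ // => ->.
have sh0 : sh 0 = 0 :> R by rewrite /sh oppr0 subrr mul0r.
by rewrite /coshint_bd !(mulr0, mul0r, sh0) addr0 subr0.
Qed.

Lemma le_sech (x : R) : sech x <= 2 * expR (- (x / 2)).
Proof.
have e0 := expR_gt0 (- (x / 2)).
rewrite -[leLHS]mul1r ler_pdivrMr ?ch_gt0 // /ch.
have := expRxMexpNx_1 (x / 2); set u := expR (x / 2); set v := expR _ in e0 * => uv.
rewrite (_ : 2 * v * _ = u * v + v ^+ 2); last by field.
by rewrite uv lerDl sqr_ge0.
Qed.

Lemma coshint_bd_le m (a x : R) : 0 <= a -> 0 <= x ->
  `|coshint_bd m a x| <= (a + m%:R / 2) * 2 ^+ m * expR ((a - m%:R / 2) * x).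
Proof.
move=> a0 x0.
have h0 := ltW (sech_gt0 x); have c0 := ltW (ch_gt0 (a * x)).
have hs : sech x * `|sh (x / 2)| <= 1.
  by rewrite mulrC ler_pdivrMr ?ch_gt0 // mul1r norm_sh_le.
have le1 : ch (a * x) <= expR (a * x).
  rewrite ler_pdivrMr // mulr_natr mulr2n lerD2l ler_expR.
  by rewrite -subr_ge0 opprK addr_ge0 // mulr_ge0.
have le2 : sech x ^+ m <= 2 ^+ m * expR (- (m%:R / 2 * x)).
  have -> : - (m%:R / 2 * x) = m%:R * (- (x / 2)) by ring.
  by rewrite expRM_natl -exprMn lerXn2r ?nnegrE ?le_sech.
apply: (@le_trans _ _ ((a + m%:R / 2) * (ch (a * x) * sech x ^+ m))).
  rewrite mulrDl; apply: (le_trans (ler_normD _ _)); apply: lerD.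
    rewrite -mulrA normrM (ger0_norm a0) ler_wpM2l // normrM.
    by rewrite [`|_ ^+ _|]ger0_norm ?exprn_ge0 // ler_wpM2r ?exprn_ge0 // norm_sh_le.
  rewrite normrM exprS (_ : _ * (sech x * _) = m%:R / 2 * (ch (a * x) * sech x ^+ m) * sech x);
    last by ring.
  rewrite normrM (ger0_norm h0) ger0_norm; last by rewrite !mulr_ge0 ?exprn_ge0.
  by rewrite -mulrA ler_piMr // !mulr_ge0 ?exprn_ge0.
rewrite -mulrA ler_wpM2l ?addr_ge0 //.
rewrite mulrBl expRD mulrCA.
by apply: ler_pM; rewrite ?exprn_ge0.
Qed.

Lemma cvg_expRNy (k : R) : k < 0 -> expR (k * x) @[x --> +oo] --> 0.
Proof.
move=> k0; have -> : (fun x => expR (k * x)) = (fun x => expR (- (- k * x))).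
  by apply/funext => x; rewrite mulNr opprK.
apply: (cvg_comp _ _ _ (@cvgr_expR R)).
by apply: gt0_cvgMry; rewrite ?oppr_gt0.
Qed.

Lemma cvg_coshint_bd m (a : R) : 0 <= a -> a < m%:R / 2 ->
  coshint_bd m a x @[x --> +oo] --> 0.
Proof.
move=> a0 am; apply/cvgr0Pnorm_le => e e0.
pose k := (a + m%:R / 2) * 2 ^+ m.
have h : k * expR ((a - m%:R / 2) * x) @[x --> +oo] --> 0.
  by rewrite -(mulr0 k); apply: cvgMr; apply: cvg_expRNy; rewrite subr_lt0.
move/cvgr0Pnorm_le: h => /(_ e e0) h.
apply: filterS2 h (nbhs_pinfty_ge (num_real 0)) => x + x0.
apply: le_trans; apply: le_trans (ler_norm _).
exact: coshint_bd_le.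
Qed.

Lemma coshint_integrand_ge0 m (a t : R) : 0 <= ch (a * t) * sech t ^+ m.
Proof. by rewrite mulr_ge0 ?exprn_ge0 // ltW // ?ch_gt0 ?sech_gt0. Qed.

Lemma coshint20 (X : R) : 0 <= X -> coshint 2 0 X = 2 * (sh (X / 2) * sech X).
Proof.
move=> X0; rewrite /coshint (@primE _ _ (fun x => 2 * (sh (x / 2) * sech x)) _ _ _ X0).
- by rewrite mul0r /sh oppr0 subrr !mul0r mulr0 subr0.
- exact: continuous_coshint.
move=> y; apply: trigger_derive; rewrite /GRing.scale /= ?(mulr0, addr0, mulr1).
have h1 : sech y ^+ 2 * sh (y / 2) ^+ 2 = 1 - sech y ^+ 2.
  have := ch2Bsh2 (y / 2); rewrite /sech => e.
  have -> : sh (y / 2) ^+ 2 = ch (y / 2) ^+ 2 - 1 by rewrite e; ring.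
  by field; rewrite gt_eqF // ch_gt0.
have h2 : sech y * ch (y / 2) = 1 by rewrite mulVf // gt_eqF // ch_gt0.
have -> : ch (0 * y) = 1 by rewrite mul0r /ch oppr0 expR0 -mulr2n divff.
transitivity (sech y * ch (y / 2) - sech y ^+ 2 * sh (y / 2) ^+ 2); first by field.
by rewrite h1 h2; ring.
Qed.

(** The duplication formula makes [a = 1] explicit, as frequency 2 was for
    the cosine. *)
Lemma coshint1 m (X : R) : coshint m.+2 1 X = 2 * coshint m 0 X - coshint m.+2 0 X.
Proof.
suff : coshint m.+2 1 X + coshint m.+2 0 X = 2 * coshint m 0 X.
  by move=> <-; rewrite addrK.
rewrite /coshint -primZ -?primD; try exact: continuous_coshint.
apply: eq_prim => t; rewrite mul1r mul0r ch_double !exprS.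
have h2 : sech t * ch (t / 2) = 1 by rewrite mulVf // gt_eqF // ch_gt0.
have -> : ch (0 : R) = 1 by rewrite /ch oppr0 expR0 -mulr2n divff.
transitivity (2 * (sech t * ch (t / 2)) ^+ 2 * sech t ^+ m); first by ring.
by rewrite h2 expr1n; ring.
Qed.

Lemma coshint_le m (a b X : R) : 0 <= a <= b ->
  coshint m a X <= coshint m b X.
Proof.
move=> /andP[a0 ab]; apply: le_prim; try exact: continuous_coshint.
move=> t /andP[t0 _].
apply: ler_wpM2r; first by rewrite exprn_ge0 // ltW // sech_gt0.
have h : a * t <= b * t by rewrite ler_wpM2r.
have at0 : 0 <= a * t by rewrite mulr_ge0.
move: (a * t) (b * t) at0 h => u v u0 uv.
rewrite ler_pM2r ?invr_gt0 // -subr_ge0 !expRN.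
set x := expR u; set y := expR v.
have x1 : 1 <= x by rewrite -expR0 ler_expR.
have xy : x <= y by rewrite ler_expR.
have x0 : 0 < x by apply: lt_le_trans x1.
have y0 : 0 < y by apply: lt_le_trans xy.
have -> : y + y^-1 - (x + x^-1) = (y - x) * (1 - (x * y)^-1).
  by field; rewrite !gt_eqF.
rewrite mulr_ge0 ?subr_ge0 // invf_le1 ?mulr_gt0 //.
by rewrite mulr_ege1 // (le_trans x1).
Qed.

(** For exponent 4 the integrals increase and are bounded by the explicit case
    [a = 1]; the recurrence brings the exponent down to 2. *)
Lemma coshint2_cvg (a : R) : 0 <= a < 1 ->
  exists l : R, coshint 2 a x @[x --> +oo] --> l.
Proof.
move=> /andP[a0 a1].
have cv4 : exists l : R, coshint 4 a x @[x --> +oo] --> l.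
  eexists; apply: nondecreasing_cvgr.
    move=> x y xy; apply: le_prim_x xy; first exact: continuous_coshint.
    by move=> t; apply: coshint_integrand_ge0.
  exists 4 => _ [x _ <-].
  have [x0|x0] := ltP x 0.
    by rewrite /coshint /prim set_itv_ge ?bnd_simp -?ltNge // Rintegral_set0.
  apply: (@le_trans _ _ (coshint 4 1 x)); first by rewrite coshint_le // a0 ltW.
  rewrite coshint1 coshint20 //.
  have h0 : 0 <= coshint 4 0 x by apply: prim_ge0 => t; exact: coshint_integrand_ge0.
  have : sh (x / 2) * sech x <= 1.
    rewrite ler_pdivrMr ?ch_gt0 // mul1r; exact: le_trans (ler_norm _) (norm_sh_le _).
  lra.
case: cv4 => l hl.
have b0 := @cvg_coshint_bd 2 a a0.
exists ((a ^+ 2 - 1)^-1 * (0 - 3 / 2 * l)).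
have ne : a ^+ 2 - 1 != 0 by rewrite subr_eq0 lt_eqF // expr_lt1.
have : (a ^+ 2 - 1)^-1 * (coshint_bd 2 a x - 3 / 2 * coshint 4 a x) @[x --> +oo]
   --> (a ^+ 2 - 1)^-1 * (0 - 3 / 2 * l).
  apply: cvgMr; apply: cvgB; last exact: cvgMr.
  by apply: b0; rewrite divff.
apply: cvg_trans; apply: near_eq_cvg.
apply: filterS (nbhs_pinfty_ge (num_real 0)) => x x0.
by rewrite -coshint_rec //; field.
Qed.

(** The factors of the recurrence that do not involve [a]. *)
Definition wallis_prod (n : nat) : R := \prod_(k < n) (k.+1.*2%:R / k.+1.*2.+1%:R).

Lemma coshint_cvg (a l : R) n : 0 <= a < 1 -> coshint 2 a x @[x --> +oo] --> l ->
  coshint n.+1.*2 a x @[x --> +oo] --> l * (euler_prod n a * wallis_prod n).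
Proof.
move=> /andP[a0 a1] hl; elim: n => [|n IH].
  by rewrite /euler_prod /wallis_prod !big_ord0 !mulr1.
set m := n.+1.*2 in IH.
have m0 : m%:R != 0 :> R by rewrite pnatr_eq0.
have m1 : m%:R + 1 != 0 :> R by rewrite natr1 pnatr_eq0.
have mE : m%:R = 2 * n.+1%:R :> R by rewrite /m -mul2n natrM.
have n0 : n.+1%:R != 0 :> R by rewrite pnatr_eq0.
have b0 : coshint_bd m a x @[x --> +oo] --> 0.
  apply: cvg_coshint_bd => //; apply: (lt_le_trans a1).
  by rewrite mE mulrAC divff // mul1r ler1n.
pose c : R := 4 / (m%:R * (m%:R + 1)).
have -> : l * (euler_prod n.+1 a * wallis_prod n.+1) =
    c * (0 + (m%:R ^+ 2 / 4 - a ^+ 2) * (l * (euler_prod n a * wallis_prod n))).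
  rewrite /euler_prod /wallis_prod !big_ord_recr /= -/m -[m.+1]addn1 natrD /c mE.
  field; have n0' := ler0n R n.
  by apply/andP; split; apply: lt0r_neq0; lra.
have : c * (coshint_bd m a x + (m%:R ^+ 2 / 4 - a ^+ 2) * coshint m a x) @[x --> +oo]
    --> c * (0 + (m%:R ^+ 2 / 4 - a ^+ 2) * (l * (euler_prod n a * wallis_prod n))).
  by apply: cvgMr; apply: cvgD => //; exact: cvgMr.
apply: cvg_trans; apply: near_eq_cvg.
apply: filterS (nbhs_pinfty_ge (num_real 0)) => x x0.
by rewrite -coshint_rec // -(natr1 m) /c; field; rewrite m0 m1.
Qed.

Lemma coshint20_cvg : coshint 2 0 x @[x --> +oo] --> (2 : R).
Proof.
have h : 1 - expR (- x) @[x --> +oo] --> (1 - 0 : R).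
  by apply: cvgB; [exact: cvg_cst|exact: cvgr_expR].
have h2 : 1 + expR (- x) @[x --> +oo] --> (1 + 0 : R).
  by apply: cvgD; [exact: cvg_cst|exact: cvgr_expR].
rewrite subr0 in h; rewrite addr0 in h2.
have h3 : 2 * ((1 - expR (- x)) / (1 + expR (- x))) @[x --> +oo] --> 2 * (1 / 1 : R).
  by apply: cvgMr; apply: cvgM => //; apply: cvgV => //; exact: oner_neq0.
rewrite divr1 mulr1 in h3; apply: cvg_trans h3; apply: near_eq_cvg.
apply: filterS (nbhs_pinfty_ge (num_real 0)) => x x0.
rewrite coshint20 // /sech /sh /ch; congr (2 * _).
have := expRxMexpNx_1 (x / 2).
have -> : expR (- x) = expR (- (x / 2)) ^+ 2 by rewrite expr2 -expRD -opprD -splitr.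
have := expR_gt0 (x / 2); have := expR_gt0 (- (x / 2)).
set u := expR (x / 2); set v := expR _ => v0 u0 uv.
have uv0 : u + v != 0 by rewrite gt_eqF ?addr_gt0.
have v20 : 1 + v ^+ 2 != 0 by rewrite gt_eqF // addr_gt0 // exprn_gt0.
transitivity ((u * v - v ^+ 2) / (u * v + v ^+ 2)); first by rewrite uv.
field; rewrite ?uv0 ?v20 //= uv ?v20 // ?uv0 //.
Qed.

Lemma euler_prod0 n : euler_prod n 0 = 1 :> R.
Proof. by apply: big1 => i _; rewrite expr0n /= mul0r subr0. Qed.

Lemma wallis_prod_gt0 n : 0 < wallis_prod n.
Proof. by apply: prodr_gt0 => i _; rewrite divr_gt0. Qed.

Lemma ler_cvgy (f g : R -> R) (a b : R) : f x @[x --> +oo] --> a ->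
  g x @[x --> +oo] --> b -> (forall x, f x <= g x) -> a <= b.
Proof.
by move=> fa gb fg; have := @ler_cvg_to _ _ _ _ _ _ _ _ fa gb; apply; exact: filterE.
Qed.

(** The integrals increase with [a], and both [a = 0] and [a = 1] are explicit:
    after [n + 1] steps of the recurrence these two values enclose the limit
    times Euler's product, within a factor [(n + 2) / (n + 1)]. *)
Lemma coshint_prod_bounds (a l : R) n : 0 <= a < 1 ->
  coshint 2 a x @[x --> +oo] --> l ->
  2 <= l * euler_prod n.+1 a <= 2 * (n.+2%:R / n.+1%:R).
Proof.
move=> a01 hl; have /andP[a0 a1] := a01.
have z01 : 0 <= (0 : R) < 1 by rewrite lexx ltr01.
have w0 := wallis_prod_gt0 n.+1.
have c1 := @coshint_cvg _ _ n.+1 a01 hl.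
have c2 := @coshint_cvg _ _ n.+1 z01 coshint20_cvg.
have c3 := @coshint_cvg _ _ n z01 coshint20_cvg.
rewrite !euler_prod0 !mul1r in c2 c3.
apply/andP; split; rewrite -(ler_pM2r w0) -[leRHS]mulrA.
  apply: (ler_cvgy c2 c1) => x.
  by rewrite coshint_le ?lexx.
have -> : 2 * (n.+2%:R / n.+1%:R * wallis_prod n.+1)
    = 2 * (2 * wallis_prod n) - 2 * wallis_prod n.+1.
  rewrite /wallis_prod big_ord_recr /= -[X in _ / X%:R]addn1 natrD -mul2n natrM -[n.+2]addn1 natrD.
  by have n0 := ler0n R n; field; rewrite -?(natr1 n); apply/andP; split; apply: lt0r_neq0; lra.
rewrite -mulrA; have c4 : 2 * coshint n.+1.*2 0 x - coshint n.+2.*2 0 x @[x --> +oo]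
    --> 2 * (2 * wallis_prod n) - 2 * wallis_prod n.+1.
  by apply: cvgB c2; exact: cvgMr.
apply: (ler_cvgy c1 c4) => x.
have := @coshint_le n.+2.*2 a 1 x; rewrite a0 ltW // => /(_ isT).
by rewrite doubleS coshint1.
Qed.

(** The reflection formula: the products in [coshint_prod_bounds] and in
    [sin_prod_bounds] cancel, which identifies the limit without evaluating
    either of them. *)
Lemma coshint2_limit (a : R) : 0 < a < 1 ->
  coshint 2 a x / 2 @[x --> +oo] --> pi * a / sin (pi * a).
Proof.
move=> /andP[a0 a1].
have a01 : 0 <= a < 1 by rewrite ltW.
have [l hl] := coshint2_cvg a01.
suff -> : pi * a / sin (pi * a) = l / 2 by apply: cvgMl.
have pa : 0 < pi * a by rewrite mulr_gt0 // pi_gt0.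
have s0 : 0 < sin (pi * a).
  by rewrite sin_gt0_pi // pa -[ltRHS]mulr1 ltr_pM2l // pi_gt0.
suff e : l / 2 * sin (pi * a) = pi * a.
  by apply: (mulIf (lt0r_neq0 s0)); rewrite e mulfVK // gt_eqF.
have l0 : 0 < l.
  have := coshint_prod_bounds 0 a01 hl.
  rewrite /euler_prod big_ord_recr big_ord0 /= mul1r => /andP[h _].
  suff : 0 < l * (1 - a ^+ 2 / 1 ^+ 2) by rewrite pmulr_lgt0 // expr1n divr1 subr_gt0 expr_lt1 // ltW.
  exact: lt_le_trans h.
have key (n : nat) : pi * a * (n.+1%:R / n.+2%:R) <= l / 2 * sin (pi * a) <=
    pi * a * (n.+2%:R / n.+1%:R).
  have /andP[b1 b2] := coshint_prod_bounds n a01 hl.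
  have := @sin_prod_bounds R n.+1 a; rewrite a0 a1 => /(_ isT) /andP[b3 b4].
  have n1 : 0 < n.+1%:R / n.+2%:R :> R by rewrite divr_gt0.
  set P := euler_prod n.+1 a in b1 b2 b3 b4.
  set q := n.+1%:R / n.+2%:R in n1 b3 *.
  apply/andP; split.
    apply: (@le_trans _ _ (l / 2 * (q * (P * (pi * a))))); last by rewrite ler_wpM2l // divr_ge0 ?ltW.
    rewrite (_ : l / 2 * _ = (pi * a * q) * ((l * P) / 2)); last by ring.
    have k0 : 0 <= pi * a * q by rewrite ltW // mulr_gt0.
    by rewrite ler_peMr // ler_pdivlMr // mul1r.
  apply: (@le_trans _ _ (l / 2 * (P * (pi * a)))); first by rewrite ler_wpM2l // divr_ge0 ?ltW.
  rewrite (_ : l / 2 * _ = (pi * a) * ((l * P) / 2)); last by ring.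
  by rewrite ler_wpM2l ?(ltW pa) // ler_pdivrMr // [leRHS]mulrC.
have c1 : pi * a * (1 - harmonic n) @[n --> \oo] --> pi * a * (1 - 0).
  by apply: cvgMr; apply: cvgB; [exact: cvg_cst|exact: cvg_harmonic].
have c2 : pi * a * (1 + harmonic n) @[n --> \oo] --> pi * a * (1 + 0).
  by apply: cvgMr; apply: cvgD; [exact: cvg_cst|exact: cvg_harmonic].
rewrite subr0 mulr1 in c1; rewrite addr0 mulr1 in c2.
have c3 : (fun=> l / 2 * sin (pi * a)) n @[n --> \oo] --> l / 2 * sin (pi * a).
  exact: cvg_cst.
apply/eqP; rewrite eq_le; apply/andP; split.
  have h := @ler_cvg_to _ _ _ _ _ _ _ _ c3 c2; apply: h; apply: filterE => n /=.
  apply: le_trans (andP (key n)).2 _; rewrite ler_wpM2l ?(ltW pa) //.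
  by rewrite /harmonic /= -(natr1 n.+1) mulrDl divff ?mul1r ?pnatr_eq0.
have h := @ler_cvg_to _ _ _ _ _ _ _ _ c1 c3; apply: h; apply: filterE => n /=.
apply: le_trans _ (andP (key n)).1; rewrite ler_wpM2l ?(ltW pa) //.
have n2 : 0 < n.+2%:R :> R by [].
have n1 : 0 < n.+1%:R :> R by [].
rewrite /harmonic /= ler_pdivlMr // mulrBl mul1r -(natr1 n.+1) mulrDr mulVf ?gt_eqF //.
by rewrite mulr1 lerBlDr addrA lerDl invr_ge0 ltW.
Qed.

Lemma abs_powR_continuous (d : R) : 0 < d -> continuous (fun t : R => `|t| `^ d).
Proof.
move=> d0 t; have [->|t0] := eqVneq t 0.
  rewrite /continuous_at normr0 powR0 ?gt_eqF //.
  apply/cvgr0Pnorm_le => e e0.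
  exists (e `^ d^-1) => /=; first exact: powR_gt0.
  move=> y /=; rewrite sub0r normrN => ye.
  have ee : (e `^ d^-1) `^ d = e by rewrite -powRrM mulVf ?gt_eqF // powRr1 // ltW.
  have := @ge0_ler_powR R d (ltW d0) `|y| (e `^ d^-1).
  by rewrite !nnegrE normr_ge0 powR_ge0 ee (ger0_norm (powR_ge0 _ _)) => /(_ isT isT (ltW ye)).
have h : derivable (fun x : R => x `^ d) `|t| 1.
  by apply: derivable_powR; rewrite in_itv /= normr_gt0 t0.
have c1 : `|x| @[x --> t] --> `|t| by exact: (@norm_continuous _ R).
have c2 : {for `|t|, continuous (fun x : R => x `^ d)}.
  by apply/differentiable_continuous/derivable1_diffP.
exact: (cvg_comp _ (fun x : R => x `^ d) c1 c2).
Qed.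

(** The absolute value makes the function continuous on the whole line. *)
Definition hill (d t : R) : R := (1 + `|t| `^ d)^-1.

Lemma hill_gt0 d t : 0 < hill d t.
Proof. by rewrite invr_gt0 ltr_pwDl // powR_ge0. Qed.

Lemma hill_le1 d t : hill d t <= 1.
Proof. by rewrite invf_le1 ?ltr_pwDl ?powR_ge0 // lerDl powR_ge0. Qed.

Lemma hill_continuous (d : R) : 1 < d -> continuous (hill d).
Proof.
move=> d1 t; apply: cvgV; first by rewrite gt_eqF // ltr_pwDl // powR_ge0.
by apply: cvgD; [exact: cvg_cst|apply: abs_powR_continuous; exact: lt_trans d1].
Qed.

(** Substitute [t = e^(s/d)] with [s] from [- S] to [S], integrate by parts in [s]
    (the terms without integral are the boundary terms), and fold the two halves
    of the symmetric interval onto each other. *)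
Lemma prim_hill_exp (d S : R) : 1 < d -> 0 <= S ->
  prim (hill d) (expR (d^-1 * S)) - prim (hill d) (expR (- (d^-1 * S))) =
  coshint 2 d^-1 S / 2 + (expR (d^-1 * S) / (1 + expR S) - expR (- (d^-1 * S)) / (1 + expR (- S))).
Proof.
move=> d1 S0; set a := d^-1.
have d0 : 0 < d by apply: lt_trans d1.
have cH := hill_continuous d1.
pose V (x : R) : R := expR (a * x) / (1 + expR x) - expR (- (a * x)) / (1 + expR (- x)).
pose W (x : R) : R := 2 * (prim (hill d) (expR (a * x)) - prim (hill d) (expR (- (a * x))) - V x).
have dW (y : R) : is_derive y 1 W (ch (a * y) * sech y ^+ 2).
  have e1 : 1 + expR y != 0 by rewrite gt_eqF // addr_gt0 // expR_gt0.
  have e2 : 1 + expR (- y) != 0 by rewrite gt_eqF // addr_gt0 // expR_gt0.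
  have h1 : is_derive (expR (a * y)) 1 (prim (hill d)) (hill d (expR (a * y))).
    exact: (is_derive_prim cH (expR_gt0 _)).
  have h2 : is_derive (expR (- (a * y))) 1 (prim (hill d)) (hill d (expR (- (a * y)))).
    exact: (is_derive_prim cH (expR_gt0 _)).
  apply: trigger_derive.
  rewrite /GRing.scale /= ?(mulr0, addr0, mulr1).
  have hE (x : R) : hill d (expR x) = (1 + expR (x * d))^-1.
    by rewrite /hill ger0_norm ?expR_ge0 // -expRM.
  have ady : a * y * d = y by rewrite mulrAC mulVf ?mul1r // gt_eqF.
  rewrite !hE mulNr ady /sech /ch !expRN.
  rewrite !expRN in e2 *.
  have p0 := lt0r_neq0 (expR_gt0 (y / 2)).
  have u0 := lt0r_neq0 (expR_gt0 (a * y)).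
  have eE : expR y = expR (y / 2) ^+ 2 by rewrite expr2 -expRD -splitr.
  rewrite eE in e1 e2 *.
  set p := expR (y / 2) in p0 e1 e2 *; set u := expR (a * y) in u0 *.
  by field; rewrite ?p0 ?u0 /= -?expr2 ?[_ + 1]addrC ?e1.
rewrite /coshint (primE _ dW S0); last exact: continuous_coshint.
rewrite /W /V !mulr0 oppr0 expR0.
move: (prim _ (expR (a * S))) (prim _ (expR (- (a * S)))) (prim _ 1) => p q s; field.
by rewrite !gt_eqF ?addr_gt0 ?expR_gt0.
Qed.

Lemma prim_hill_le (d x : R) : 1 < d -> 0 <= x -> prim (hill d) x <= x.
Proof.
move=> d1 x0; apply: (@le_trans _ _ (prim (fun=> 1) x)).
  apply: le_prim; [exact: hill_continuous|by move=> ?; exact: cvg_cst|].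
  by move=> t _; exact: hill_le1.
by rewrite (@primE _ _ id) ?subr0 //; move=> ?; exact: cvg_cst.
Qed.

Lemma prim_hill_cvg (d : R) : 1 < d ->
  prim (hill d) x @[x --> +oo] --> pi / (d * sin (pi / d)).
Proof.
move=> d1; have d0 : 0 < d by apply: lt_trans d1.
pose a := d^-1.
have a0 : 0 < a by rewrite invr_gt0.
have a1 : a < 1 by rewrite invf_lt1.
have c0 : coshint 2 a x / 2 @[x --> +oo] --> pi * a / sin (pi * a).
  by apply: coshint2_limit; rewrite a0.
have cV1 : expR (a * x) / (1 + expR x) @[x --> +oo] --> 0.
  have h : expR ((a - 1) * x) @[x --> +oo] --> 0 by apply: cvg_expRNy; rewrite subr_lt0.
  apply: (squeeze_cvgr _ (cvg_cst 0) h); apply: filterE => x.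
  rewrite divr_ge0 ?addr_ge0 ?expR_ge0 //= ler_pdivrMr ?addr_gt0 ?expR_gt0 //.
  rewrite mulrBl mul1r mulrDr mulr1 expRD -mulrA [expR (- x) * _]mulrC expRxMexpNx_1.
  by rewrite mulr1 lerDr mulr_ge0 ?expR_ge0.
have ha : expR (- (a * x)) @[x --> +oo] --> 0.
  have -> : (fun x => expR (- (a * x))) = (fun x => expR (- a * x)).
    by apply/funext => x; rewrite mulNr.
  by apply: cvg_expRNy; rewrite oppr_lt0.
have cV2 : expR (- (a * x)) / (1 + expR (- x)) @[x --> +oo] --> 0.
  apply: (squeeze_cvgr _ (cvg_cst 0) ha); apply: filterE => x.
  rewrite divr_ge0 ?addr_ge0 ?expR_ge0 //= ler_pdivrMr ?addr_gt0 ?expR_gt0 //.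
  by rewrite ler_peMr ?expR_ge0 // lerDl expR_ge0.
have c3 : prim (hill d) (expR (- (a * x))) @[x --> +oo] --> 0.
  apply: (squeeze_cvgr _ (cvg_cst 0) ha); apply: filterE => x.
  rewrite prim_hill_le ?expR_ge0 // andbT.
  by apply: prim_ge0 => t; rewrite ltW // hill_gt0.
have c4 : prim (hill d) (expR (a * x)) @[x --> +oo] --> pi / (d * sin (pi / d)).
  have -> : pi / (d * sin (pi / d)) = pi * a / sin (pi * a) + (0 - 0) + 0.
    by rewrite subr0 !addr0 /a invfM mulrA.
  have c5 : coshint 2 a x / 2 + (expR (a * x) / (1 + expR x) -
      expR (- (a * x)) / (1 + expR (- x))) + prim (hill d) (expR (- (a * x)))
      @[x --> +oo] --> pi * a / sin (pi * a) + (0 - 0) + 0.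
    by apply: cvgD c3; apply: cvgD c0 _; exact: cvgB.
  apply: cvg_trans c5; apply: near_eq_cvg.
  apply: filterS (nbhs_pinfty_ge (num_real 0)) => x x0.
  by apply/eqP; rewrite eq_sym -subr_eq; apply/eqP; exact: prim_hill_exp.
have cl : a^-1 * ln x @[x --> +oo] --> +oo.
  apply: gt0_cvgMry; first by rewrite invr_gt0.
  apply/cvgryPge => A; apply: filterS (nbhs_pinfty_ge (num_real (expR A))) => x h.
  by rewrite -[leLHS]expRK ler_ln ?posrE ?expR_gt0 // (lt_le_trans (expR_gt0 A)).
have c6 := cvg_comp _ _ cl c4.
apply: cvg_trans c6; apply: near_eq_cvg.
apply: filterS (nbhs_pinfty_gt (num_real 0)) => x x0 /=.
by rewrite mulrA divff ?gt_eqF // mul1r lnK.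
Qed.

Lemma prim_hill_scale (d k b x : R) : 1 < d -> 0 < b -> b `^ d = k -> 0 <= x ->
  prim (fun t => k * (1 + k * `|t| `^ d)^-1) x = k / b * prim (hill d) (b * x).
Proof.
move=> d1 b0 bk x0.
have k0 : 0 < k by rewrite -bk powR_gt0.
have E (t : R) : k * (1 + k * `|t| `^ d)^-1 = k * hill d (b * t).
  by rewrite /hill normrM (gtr0_norm b0) powRM ?normr_ge0 ?ltW // bk.
rewrite (eq_prim _ E).
pose W (y : R) := k / b * prim (hill d) (b * y).
have ch := hill_continuous d1.
suff -> : prim (fun t => k * hill d (b * t)) x = W x - W 0.
  by rewrite /W mulr0 prim0 mulr0 subr0.
apply: primE_gt0; last exact: x0.
- move=> t; apply: cvgM; first exact: cvg_cst.
  have c1 : b * y @[y --> t] --> b * t by apply: cvgMr; exact: cvg_id.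
  exact: (cvg_comp _ _ c1 (ch (b * t))).
- move=> y y0.
  have h : is_derive (b * y) 1 (prim (hill d)) (hill d (b * y)).
    by apply: is_derive_prim => //; rewrite mulr_gt0.
  apply: trigger_derive; rewrite /GRing.scale /= ?(mulr0, addr0, mulr1).
  by field; rewrite gt_eqF.
- have h : k / b * (b * y) @[y --> 0^'+] --> k / b * (b * 0).
    by apply: cvg_at_right_filter; apply: cvgMr; apply: cvgMr; exact: cvg_id.
  rewrite !mulr0 in h; rewrite /W mulr0 prim0 mulr0.
  apply: (squeeze_cvgr _ (cvg_cst 0) h).
  near=> y; have y0 : 0 < y by near: y; exact: nbhs_right_gt.
  have kb : 0 <= k / b by rewrite divr_ge0 ?ltW.
  rewrite mulr_ge0 ?prim_ge0 //=; last by move=> t; rewrite ltW ?hill_gt0.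
  by rewrite ler_wpM2l // prim_hill_le // mulr_ge0 // ltW.
Unshelve. all: by end_near. Qed.

End Hyperbolic.
(** * Greedy and stable matchings *)
Section Greedy.
Context {n : nat}.
Implicit Types (e f : edge n) (M s : seq (edge n)).

Definition share e f := (e.1 == f.1) || (e.2 == f.2).
Definition free M e := ~~ has (share e) M.
Definition greedy_step M e := if free M e then e :: M else M.
Definition greedy M s := foldl greedy_step M s.
(** A matching misses equally many vertices on the two sides; this is their
    number on one side. *)
Definition unmatched M := (n - size M)%N.

Lemma greedy_cat M s t : greedy M (s ++ t) = greedy (greedy M s) t.
Proof. exact: foldl_cat. Qed.

Lemma greedy_sub M s : {subset M <= greedy M s}.
Proof.
elim: s M => [|a s IH] M e eM //=; apply: IH; rewrite /greedy_step.
by case: ifP => _ //; rewrite inE eM orbT.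
Qed.

Lemma mem_greedy M s e : e \in greedy M s -> (e \in M) || (e \in s).
Proof.
elim: s M => [|a s IH] M /=; first by move->.
move=> /IH; rewrite /greedy_step; case: ifP => _; rewrite !inE => /orP[] h.
- by case/orP: h => -> ; rewrite ?orbT.
- by rewrite h !orbT.
- by rewrite h.
- by rewrite h !orbT.
Qed.

Lemma free_greedy M s e : free (greedy M s) e -> free M e.
Proof.
apply: contra => /hasP[f fM sf]; apply/hasP; exists f => //.
exact: greedy_sub.
Qed.

Lemma greedy_maximal M s e : e \in s -> ~~ free (greedy M s) e.
Proof.
elim: s M => //= a s IH M; rewrite inE => /orP[/eqP ->|/IH]; last exact.
apply/negP => /free_greedy; rewrite /greedy_step; case: ifP => [fa|->//].
by rewrite /free /= /share eqxx.
Qed.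

Definition matching M := pairwise (fun e f => ~~ share e f) M.

Lemma greedy_matching M s : matching M -> matching (greedy M s).
Proof.
elim: s M => //= a s IH M mM; apply: IH; rewrite /greedy_step.
case: ifP => //= fa; rewrite mM andbT.
by move: fa; rewrite /free -all_predC.
Qed.

Lemma matching_uniq1 M : matching M -> uniq (map fst M).
Proof.
elim: M => //= e M IH /andP[/allP ha /IH ->]; rewrite andbT.
by apply/negP => /mapP[f fM ef]; have := ha _ fM; rewrite /share ef eqxx.
Qed.

Lemma matching_uniq2 M : matching M -> uniq (map snd M).
Proof.
elim: M => //= e M IH /andP[/allP ha /IH ->]; rewrite andbT.
by apply/negP => /mapP[f fM ef]; have := ha _ fM; rewrite /share ef eqxx orbT.
Qed.

Lemma matching_uniq M : matching M -> uniq M.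
Proof. by move/matching_uniq1; exact: map_uniq. Qed.

Lemma freeE M e : free M e = (e.1 \notin map fst M) && (e.2 \notin map snd M).
Proof.
elim: M => //= a M IH.
rewrite /free /= negb_or !inE /share in IH *; rewrite IH !negb_or.
by rewrite -!andbA; congr (_ && _); rewrite andbCA.
Qed.

Lemma card_predC_uniq (t : seq 'I_n) : uniq t -> #|[predC t]| = (n - size t)%N.
Proof.
move=> /card_uniqP <-; have h := cardC (mem t); rewrite card_ord in h.
by rewrite -[LHS](addKn #|mem t|); congr (_ - _)%N.
Qed.

(** An edge is free when both its endpoints are unmatched, so the free edges
    form a product of two sets of size [unmatched M]. *)
Lemma card_free M : matching M -> #|[pred e | free M e]| = (unmatched M ^ 2)%N.
Proof.
move=> mM.
have c1 := card_predC_uniq (matching_uniq1 mM).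
have c2 := card_predC_uniq (matching_uniq2 mM).
rewrite !size_map in c1 c2; rewrite -mulnn /unmatched -{1}c1 -c2 -cardX.
by apply: eq_card => e; rewrite !inE freeE.
Qed.

Lemma matching_size M : matching M -> (size M <= n)%N.
Proof.
move=> mM; rewrite -(size_map fst) -[leqRHS]card_ord.
have /card_uniqP <- := matching_uniq1 mM; exact: max_card.
Qed.

Lemma matchingP M e f : matching M -> e \in M -> f \in M -> e != f -> ~~ share e f.
Proof.
elim: M => //= a M IH /andP[/allP ha mM]; rewrite !inE.
have shC g h : share g h = share h g by rewrite /share eq_sym [g.2 == _]eq_sym.
move=> /orP[/eqP->|eM] /orP[/eqP->|fM]; first by rewrite eqxx.
- by move=> _; exact: ha.
- by move=> _; rewrite shC; exact: ha.
- exact: IH.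
Qed.

(** An edge is only refused because of an adjacent edge that was examined
    before it. *)
Lemma greedy_blocked (r : rel (edge n)) s e : transitive r -> sorted r s ->
  e \in s -> e \notin greedy [::] s ->
  exists f, [/\ f \in greedy [::] s, share e f & r f e].
Proof.
move=> rt; elim/last_ind: s => // s a IH; rewrite -cats1 greedy_cat /=.
move=> ss; have ss1 : sorted r s by apply: subseq_sorted ss; [|exact: prefix_subseq].
rewrite mem_cat => /orP[es|].
  move=> eG; have [|f [fG sf rf]] := IH ss1 es.
    by apply: contra eG => eG; rewrite /greedy_step; case: ifP; rewrite ?inE eG ?orbT.
  exists f; split=> //.
  by rewrite /greedy_step; case: ifP; rewrite ?inE fG ?orbT.
rewrite inE => /eqP ->; rewrite /greedy_step.
case: ifP => [|/negbFE/hasP[f fG sf] _]; first by rewrite inE eqxx.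
exists f; split=> //.
have fs : f \in s by have := mem_greedy fG.
move: ss; rewrite (sorted_pairwise rt) pairwise_cat => /and3P[/allrelP h _ _].
by apply: h; rewrite ?inE.
Qed.

End Greedy.

Section Levels.
Context {R : realType} {n : nat}.
Implicit Types (w : edge n -> R) (e f : edge n).

(** Ties are broken by the enumeration of the edges: the order is then total and
    antisymmetric for all costs, and what the algorithm does depends only on
    comparisons of costs. *)
Definition key w e : (R *l nat)%type := (w e, val (enum_rank e)).
Definition edge_le w : rel (edge n) := fun e f => (key w e <= key w f)%O.
Definition edges_by w := sort (edge_le w) (enum {: edge n}).
Definition matched w := greedy [::] (edges_by w).
(** The state of the algorithm once the edges of cost at most [x] have been
    examined. *)
Definition level w (x : R) := greedy [::] [seq e <- edges_by w | w e <= x].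

Lemma edge_le_trans w : transitive (edge_le w).
Proof. by move=> f e g; exact: le_trans. Qed.

Lemma edge_le_total w : total (edge_le w).
Proof. by move=> e f; exact: le_total. Qed.

Lemma edge_le_anti w : antisymmetric (edge_le w).
Proof.
move=> e f /le_anti /eqP; rewrite xpair_eqE => /andP[_ /eqP h].
by apply: enum_rank_inj; apply: val_inj.
Qed.

Lemma edge_leW w e f : edge_le w e f -> w e <= w f.
Proof. by rewrite /edge_le lexi_pair => /andP[]. Qed.

Lemma edges_by_sorted w : sorted (edge_le w) (edges_by w).
Proof. exact: sort_sorted (edge_le_total w) _. Qed.

Lemma mem_edges_by w e : e \in edges_by w.
Proof. by rewrite mem_sort mem_enum. Qed.

Lemma edges_by_uniq w : uniq (edges_by w).
Proof. by rewrite sort_uniq enum_uniq. Qed.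

Lemma level_matching w x : matching (level w x).
Proof. exact: greedy_matching. Qed.

(** Costs above the threshold are irrelevant.  This is what will make the
    cost of a free edge independent of the state. *)
Lemma eq_level w w' (x x' : R) : (forall e, (w e <= x) = (w' e <= x')) ->
  (forall e f, w e <= x -> w f <= x -> edge_le w e f = edge_le w' e f) ->
  level w x = level w' x'.
Proof.
move=> ww' rr'; rewrite /level; congr greedy.
have tr := @edge_le_trans w; have tr' := @edge_le_trans w'.
apply: (sorted_eq tr (@edge_le_anti w)).
- exact: sorted_filter (edges_by_sorted w).
- apply: (@sub_in_sorted _ [pred e | w e <= x] (edge_le w')).
  + by move=> e f /= ex fx; rewrite rr'.
  + by apply/allP => e; rewrite mem_filter /= ww' => /andP[].
  + exact: sorted_filter (edges_by_sorted w').
- apply: uniq_perm; rewrite ?filter_uniq ?edges_by_uniq // => e.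
  by rewrite !mem_filter !mem_edges_by ww'.
Qed.

Lemma sorted_filter_cat (p q : pred (edge n)) w s : sorted (edge_le w) s ->
  (forall e f, edge_le w e f -> q f -> q e) -> (forall e, q e -> p e) ->
  [seq e <- s | p e] = [seq e <- s | q e] ++ [seq e <- s | p e && ~~ q e].
Proof.
move=> ss qd qp; elim: s ss => //= e s IH pes.
have ss : sorted (edge_le w) s by exact: path_sorted pes.
have := IH ss; case qe: (q e); first by rewrite (qp _ qe) => -> .
rewrite andbT => IH'.
have q0 : [seq e <- s | q e] = [::].
  apply/eqP; rewrite -(negbK (_ == _)) -has_filter; apply/hasPn => f fs.
  apply/negP => qf; move/negP: qe; apply; apply: qd qf.
  by move: pes; rewrite (path_sortedE (edge_le_trans (w := w))) => /andP[/allP h _]; exact: h.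
by rewrite IH' q0; case: (p e).
Qed.

Lemma level_cat w (x y : R) : x <= y ->
  level w y = greedy (level w x) [seq e <- edges_by w | x < w e <= y].
Proof.
move=> xy; rewrite /level -greedy_cat; congr greedy.
rewrite (sorted_filter_cat (p := fun e => w e <= y) (q := fun e => w e <= x) (edges_by_sorted w)).
- by congr (_ ++ _); apply: eq_filter => e; rewrite -ltNge andbC.
- by move=> e f /edge_leW; exact: le_trans.
- by move=> e ex; exact: le_trans xy.
Qed.

Lemma matched_level w (x : R) :
  matched w = greedy (level w x) [seq e <- edges_by w | x < w e].
Proof.
rewrite /matched /level -greedy_cat; congr greedy.
rewrite -[LHS]filter_predT (sorted_filter_cat (p := predT) (q := fun e => w e <= x) (edges_by_sorted w)) //.
- by congr (_ ++ _); apply: eq_filter => e; rewrite -ltNge.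
- by move=> e f /edge_leW; exact: le_trans.
Qed.

Lemma mem_level w (x : R) e : e \in level w x = (e \in matched w) && (w e <= x).
Proof.
rewrite (matched_level w x); apply/idP/andP => [eL|[]].
  split; first exact: greedy_sub.
  by have := mem_greedy eL; rewrite /= mem_filter => /andP[].
by move=> /mem_greedy; rewrite mem_filter => /orP[//|/andP[]]; rewrite ltNge => /negbTE ->.
Qed.

Lemma level_free w (x : R) e : free (level w x) e -> x < w e.
Proof.
rewrite ltNge; apply: contraTN => ex; apply: greedy_maximal.
by rewrite mem_filter ex mem_edges_by.
Qed.

Definition nfree w (x : R) : nat := unmatched (level w x).
Definition window w (x y : R) e : bool := x < w e <= y.
(** The change of [f (nfree w x)] when [e] is the only edge examined after
    threshold [x]: a free edge joins the matching, another one is refused. *)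
Definition jump (f : nat -> R) w (x : R) e : R :=
  (free (level w x) e)%:R * (f (nfree w x).-1 - f (nfree w x)).

Lemma nfree_le w x : (nfree w x <= n)%N.
Proof. exact: leq_subr. Qed.

Lemma sum_window (F : edge n -> R) w (x y : R) :
  \sum_e (window w x y e)%:R * F e = \sum_(e <- [seq e <- edges_by w | window w x y e]) F e.
Proof.
rewrite big_filter [RHS](perm_big (enum {: edge n})) ?perm_sort //= big_enum_cond /=.
rewrite [RHS]big_mkcond; apply: eq_bigr => e _.
by case: (window _ _ _ _); rewrite ?mul1r ?mul0r.
Qed.

Lemma sum_window_pairs w (x y : R) (k := size [seq e <- edges_by w | window w x y e]) :
  \sum_e \sum_(g | g != e) ((window w x y e)%:R * (window w x y g)%:R) = k%:R * k%:R - k%:R :> R.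
Proof.
have s1 : \sum_e (window w x y e)%:R = k%:R :> R.
  under eq_bigr do rewrite -[_%:R]mulr1.
  by rewrite sum_window big_const_seq count_predT iter_addr_0.
have h e : \sum_(g | g != e) ((window w x y e)%:R * (window w x y g)%:R)
    = (window w x y e)%:R * k%:R - (window w x y e)%:R :> R.
  rewrite -mulr_sumr -s1 [in RHS](bigD1 e) //= mulrDr -natrM mulnb andbb.
  by rewrite addrAC subrr add0r.
under eq_bigr do rewrite h.
by rewrite sumrB -mulr_suml s1.
Qed.

(** With at most one edge in the window the formula is exact.  With [k >= 2]
    edges the error is at most [(2 k + 2) B], which the [k (k - 1)] ordered pairs
    of edges in the window absorb. *)
Lemma generator_step (f : nat -> R) (B : R) w (x y : R) : x <= y ->
  (forall k, (k <= n)%N -> `|f k| <= B) ->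
  `|f (nfree w y) - f (nfree w x) - \sum_e (window w x y e)%:R * jump f w x e|
  <= 3 * B * \sum_e \sum_(g | g != e) ((window w x y e)%:R * (window w x y g)%:R).
Proof.
move=> xy fB; rewrite sum_window_pairs sum_window.
have jB e : `|jump f w x e| <= 2 * B.
  rewrite normrM ger0_norm // -[leRHS]mul1r; apply: ler_pM => //.
    by case: (free _ _).
  rewrite mulr_natl mulr2n; apply: le_trans (ler_normB _ _) _; apply: lerD; apply: fB.
    by apply: leq_trans (leq_pred _) _; exact: nfree_le.
  exact: nfree_le.
have B0 : 0 <= B by apply: le_trans (fB 0%N _).
rewrite {1}/nfree (level_cat w xy); case: [seq e <- edges_by w | _] => [|a [|b s]].
- by rewrite big_nil subr0 /= subrr normr0 mulr0n mul0r subr0 mulr0.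
- rewrite big_seq1 /= mulr1n mulr1 subrr mulr0 /jump /greedy_step.
  case: (free _ a); last by rewrite mul0r subrr subr0 normr0.
  by rewrite mul1r {1}/unmatched /= subnS -/(unmatched _) -/(nfree _ _) subrr normr0.
- set t := b :: s; set k := size _; have k2 : 2 <= k%:R :> R by rewrite ler_nat.
  apply: (@le_trans _ _ (2 * B + k%:R * (2 * B))).
    apply: le_trans (ler_normB _ _) _; apply: lerD.
      rewrite mulr_natl mulr2n; apply: le_trans (ler_normB _ _) _; apply: lerD; apply: fB.
        exact: leq_subr.
      exact: nfree_le.
    apply: le_trans (ler_norm_sum _ _ _) _.
    apply: (@le_trans _ _ (\sum_(e <- a :: t) (2 * B))); first exact: ler_sum.
    by rewrite big_const_seq count_predT iter_addr_0 -/k -[leLHS]mulr_natl.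
  have -> : 3 * B * (k%:R * k%:R - k%:R) = B * (3 * k%:R * (k%:R - 1)) by ring.
  have -> : 2 * B + k%:R * (2 * B) = B * (2 + 2 * k%:R) by ring.
  rewrite ler_wpM2l //; nra.
Qed.

(** At most one edge of a matching is incident to a vertex, so a vertex is
    better off than with [e] exactly when some cheaper edge of the matching
    covers it; the infinite costs of unmatched vertices disappear. *)
Lemma is_stableP w (M : {set edge n}) : is_stable_matching w M <->
  is_matching M /\ forall e, e \notin M -> exists2 f, f \in M & share e f && (w f < w e).
Proof.
split=> -[mM sM]; split=> //.
  move=> [v v'] /negP eM; case: (sM v v') => // h; move: h.
  - move=> /bigmin_ltP[//|[f /andP[fM /eqP fv]]]; rewrite lte_fin => h.
    by exists f => //; rewrite /share fv eqxx h.
  - move=> /bigmin_ltP[//|[f /andP[fM /eqP fv]]]; rewrite lte_fin => h.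
    by exists f => //; rewrite /share fv eqxx orbT h.
move=> v v'; have [eM|eM] := boolP ((v, v') \in M); first by constructor 1.
have [f fM /andP[]] := sM _ eM; rewrite /share /= => /orP[/eqP fv|/eqP fv] h.
- by constructor 2; apply/bigmin_ltP; right; exists f; rewrite ?lte_fin // fM fv eqxx.
- by constructor 3; apply/bigmin_ltP; right; exists f; rewrite ?lte_fin // fM fv eqxx.
Qed.

(** The cheapest edge on which two stable matchings differ belongs to one of them
    and is blocked in the other by a cheaper edge, on which they differ too. *)
Lemma stable_unique w (M M' : {set edge n}) : injective w ->
  is_stable_matching w M -> is_stable_matching w M' -> M = M'.
Proof.
move=> wi sM sM'.
have aux (A B : {set edge n}) e : is_stable_matching w A -> is_stable_matching w B ->
    e \in A -> e \notin B -> (forall f, (f \in A) (+) (f \in B) -> w e <= w f) -> False.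
  move=> /is_stableP sA /is_stableP sB eA eB emin.
  have [f fB /andP[sf lt]] := sB.2 e eB.
  have fA : f \in A.
    apply/negPn/negP => fA; suff /emin : (f \in A) (+) (f \in B) by rewrite leNgt lt.
    by rewrite fB (negbTE fA).
  apply: (sA.1 e f eA fA); split; first by move=> ef; rewrite ef ltxx in lt.
  by case/orP: sf => /eqP ->; [left|right].
pose p e := (e \in M) (+) (e \in M').
apply/setP => e0; apply/eqP; rewrite -negb_add -/(p e0); apply/negP => p0.
have [e pe emin] : exists2 e, p e & forall f, p f -> w e <= w f.
  by case: (@arg_minP _ _ _ e0 p w p0) => e pe h; exists e.
have [eM|eM] := boolP (e \in M); have := pe; rewrite /p.
  by rewrite eM /= => eM'; exact: (aux M M' e).
rewrite (negbTE eM) /= => eM'; apply: (aux M' M e) => // f.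
by rewrite addbC; exact: emin.
Qed.

Lemma matched_stable w : injective w ->
  is_stable_matching w [set e in matched w]%SET.
Proof.
move=> wi; apply/is_stableP; split.
  move=> e f; rewrite !inE => eM fM [/eqP ef h].
  have mm : matching (matched w) by exact: greedy_matching.
  have := matchingP mm eM fM ef.
  by rewrite /share; case: h => ->; rewrite eqxx ?orbT.
move=> e; rewrite inE => eM.
have [f [fM sf fe]] := greedy_blocked (edge_le_trans (w := w)) (edges_by_sorted w) (mem_edges_by w e) eM.
exists f; first by rewrite inE.
rewrite sf lt_neqAle edge_leW // andbT; apply/negP => /eqP /wi fe'.
by move: eM; rewrite -fe' fM.
Qed.

Lemma stable_cost_matched w : injective w ->
  stable_cost w = \sum_(e <- matched w) w e.
Proof.
move=> wi; have -> : \sum_(e <- matched w) w e = \sum_(e in [set e in matched w]%SET) w e.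
  rewrite big_uniq ?matching_uniq ?greedy_matching //.
  by apply: eq_bigl => e; rewrite inE.
rewrite /stable_cost; suff -> : stable_matching w = [set e in matched w]%SET by [].
have sm := matched_stable wi.
apply: xget_unique => // M sM.
exact: stable_unique sM sm.
Qed.

(** No edge is free at the end, and the number of free edges is the square of
    the number of unmatched vertices. *)
Lemma matched_size w : size (matched w) = n.
Proof.
have mm : matching (matched w) by exact: greedy_matching.
have : #|[pred e | free (matched w) e]| = 0%N.
  apply: eq_card0 => e; rewrite inE; apply/negbTE.
  by apply: greedy_maximal; exact: mem_edges_by.
rewrite card_free // => /eqP; rewrite expn_eq0 andbT subn_eq0 => h.
by apply/eqP; rewrite eqn_leq h matching_size.
Qed.

(** For all costs, including those with ties, the matching chosen in the
    definition depends only on comparisons; its cost is therefore measurable. *)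
Lemma eq_stable_matching w w' : (forall e f, (w e <= w f) = (w' e <= w' f)) ->
  stable_matching w = stable_matching w'.
Proof.
move=> ww'; rewrite /stable_matching; congr xget; apply/funext => M /=.
have lt e f : (w e < w f) = (w' e < w' f) by rewrite !ltNge ww'.
apply/propext; split=> /is_stableP[mM sM]; apply/is_stableP; split=> // e /sM[f fM].
  by rewrite lt; exists f.
by rewrite -lt; exists f.
Qed.

Lemma eq_edge_le w w' : (forall e f, (w e <= w f) = (w' e <= w' f)) ->
  edge_le w =2 edge_le w'.
Proof. by move=> ww' e f; rewrite /edge_le !lexi_pair /= !ww'. Qed.

(** The final matching is perfect, so each vertex unmatched at threshold [x] is
    matched later, by an edge of cost above [x]. *)
Lemma nfree_count w (x : R) :
  nfree w x = count (fun e => x < w e) (matched w).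
Proof.
have mm : matching (matched w) by exact: greedy_matching.
have pe : perm_eq (level w x) [seq e <- matched w | w e <= x].
  apply: uniq_perm; rewrite ?filter_uniq ?matching_uniq ?level_matching // => e.
  by rewrite mem_level mem_filter andbC.
have := matched_size w; rewrite -(count_predC (fun e => w e <= x)) => sz.
rewrite /nfree /unmatched (perm_size pe) size_filter.
rewrite -[X in (X - _)%N]sz addKn.
by apply: eq_count => e /=; rewrite ltNge.
Qed.

End Levels.
(** * Functions of finitely many comparisons, and independence *)
Section FinitelyDetermined.
Context d {T : measurableType d}.

(** The outcomes of the finitely many tests split [T] into measurable sets on
    which [g] is constant, whatever the codomain of [g]. *)
Lemma measurable_determined (I : finType) (b : I -> T -> bool) K (g : T -> K) (A : set K) :
  (forall i, measurable_fun [set: T] (b i)) ->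
  (forall t t', (forall i, b i t = b i t') -> g t = g t') ->
  measurable (g @^-1` A).
Proof.
move=> mb hg; pose pat t : {ffun I -> bool} := [ffun i => b i t].
have mpat k : measurable (pat @^-1` [set k]).
  rewrite (_ : _ @^-1` _ = \bigcap_(i in [set: I]) (b i @^-1` [set k i])); last first.
    apply/seteqP; split=> t /=; first by move=> <- i _; rewrite /= ffunE.
    by move=> h; apply/ffunP => i; rewrite ffunE; exact: h.
  apply: fin_bigcap_measurable => // i _; rewrite -[X in measurable X]setTI; exact: mb.
rewrite (_ : _ @^-1` _ = \bigcup_(k in [set k | exists2 t, pat t = k & A (g t)]) (pat @^-1` [set k])).
  by apply: fin_bigcup_measurable => // k _; exact: mpat.
apply/seteqP; split=> t /=; first by move=> At; exists (pat t) => //; exists t.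
move=> [_ [t' <- At'] h].
by rewrite (hg t t') // => i; move/ffunP/(_ i): h; rewrite !ffunE.
Qed.

Lemma measurable_pattern {R : realType} (E : finType) (w : E -> T -> R) (x : T -> R)
    K (g : T -> K) (A : set K) :
  (forall e, measurable_fun [set: T] (w e)) -> measurable_fun [set: T] x ->
  (forall t t', (forall e f, (w e t <= w f t) = (w e t' <= w f t')) ->
     (forall e, (w e t <= x t) = (w e t' <= x t')) -> g t = g t') ->
  measurable (g @^-1` A).
Proof.
move=> mw mx hg.
pose b (i : (E * E) + E) t := match i with inl p => w p.1 t <= w p.2 t | inr e => w e t <= x t end.
apply: (@measurable_determined _ b) => [[p|e]|t t' h] /=.
- exact: measurable_fun_ler.
- exact: measurable_fun_ler.
- by apply: hg => [e f|e]; [exact: (h (inl (e, f)))|exact: (h (inr e))].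
Qed.

End FinitelyDetermined.

Section Independence.
Context d {T : measurableType d} {R : realType} (P : probability T R).
Context {E : finType} (X : E -> {RV P >-> R}).
Hypothesis indep : mutually_independent P X.

(** A pi-system generating the events that depend on the variables other than
    [X e]. *)
Definition cylinders_off (e : E) : set (set T) :=
  [set B | exists2 A : E -> set R, (forall f, measurable (A f)) &
     B = \bigcap_(f in [set f | f != e]) (X f @^-1` A f)].

Lemma cylinders_off_setI e : setI_closed (cylinders_off e).
Proof.
move=> _ _ [A mA ->] [A' mA' ->]; exists (fun f => A f `&` A' f).
  by move=> f; exact: measurableI.
by rewrite -bigcapI; apply: eq_bigcapr => f _; rewrite preimage_setI.
Qed.

Lemma cylinders_off_measurable e : <<s cylinders_off e >> `<=` measurable.
Proof.
apply: smallest_sub; first exact: sigma_algebra_measurable.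
move=> _ [A mA ->]; apply: fin_bigcap_measurable => [|f _]; first exact: finite_finset.
by rewrite -[X in measurable X]setTI; exact: (measurable_funPT (X f)).
Qed.

Lemma indep_cylinder e (A : set R) (B : set T) : measurable A -> cylinders_off e B ->
  P ((X e @^-1` A) `&` B) = (P (X e @^-1` A) * P B)%E.
Proof.
move=> mA [C mC ->].
pose C' f := if f == e then A else C f.
have mC' f : measurable (C' f) by rewrite /C'; case: ifP.
have hT f : [set` [set: E]%SET] f by rewrite /= finset.in_setT.
have -> : X e @^-1` A `&` \bigcap_(f in [set f | f != e]) X f @^-1` C f
   = \bigcap_(f in [set` [set: E]%SET]) X f @^-1` C' f.
  apply/seteqP; split=> t /=.
    by move=> [Xe h] f _; rewrite /C' /=; case: eqP => [->//|/eqP fe]; exact: h.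
  move=> h; split; first by have := h e (hT e); rewrite /C' /= eqxx.
  by move=> f fe; have := h f (hT f); rewrite /C' /= (negbTE fe).
rewrite indep // (bigD1 e) ?finset.in_setT //= /C' eqxx; congr (_ * _)%E.
have -> : \bigcap_(f in [set f | f != e]) X f @^-1` C f
   = \bigcap_(f in [set` [set~ e]%SET]) X f @^-1` C' f.
  apply/seteqP; split=> t /= h f; have := h f.
    by rewrite /= !inE /C' => hf fe; rewrite (negbTE fe); exact: hf.
  by rewrite /= !inE /C' => hf fe; have := hf fe; rewrite (negbTE fe).
rewrite indep //; apply: eq_big => f; first by rewrite !inE.
by rewrite /C' => /andP[_ /negbTE ->].
Qed.

(** Independence is assumed for product events only; Dynkin's theorem extends
    it to the generated sigma-algebra. *)
Lemma indep_off e (A : set R) (B : set T) : measurable A -> <<s cylinders_off e >> B ->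
  P ((X e @^-1` A) `&` B) = (P (X e @^-1` A) * P B)%E.
Proof.
move=> mA; move: B.
have mXA : measurable (X e @^-1` A).
  by rewrite -[X in measurable X]setTI; exact: (measurable_funPT (X e)).
have stepC (B : set T) : measurable B ->
    P ((X e @^-1` A) `&` B) = (P (X e @^-1` A) * P B)%E ->
    P ((X e @^-1` A) `&` ~` B) = (P (X e @^-1` A) * P (~` B))%E.
  move=> mB h; have fA := fin_num_measure P _ mXA.
  rewrite probability_setC // muleBr ?fin_num_adde_defr // mule1 -h.
  rewrite -setDE measureD //.
  by rewrite (le_lt_trans (probability_le1 P mXA)) // ltry.
have stepU (F : (set T)^nat) : (forall n, measurable (F n)) -> trivIset [set: nat] F ->
    (forall n, P ((X e @^-1` A) `&` F n) = (P (X e @^-1` A) * P (F n))%E) ->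
    P ((X e @^-1` A) `&` \bigcup_k F k) = (P (X e @^-1` A) * P (\bigcup_k F k))%E.
  move=> mF tF h.
  rewrite setI_bigcupr measure_bigcup //; last 2 first.
    by move=> n _; exact: measurableI.
    by apply: trivIset_setIl.
  transitivity (\sum_(0 <= i <oo | i \in [set: nat]) (P (X e @^-1` A) * P (F i)))%E.
    by apply: eq_eseriesr => i _; exact: h.
  by rewrite -(fineK (fin_num_measure P _ mXA)) nneseriesZl // measure_bigcup.
apply: (@dynkin_induction _ (g_sigma_algebraType (cylinders_off e)) (cylinders_off e)
  (fun B => P ((X e @^-1` A) `&` B) = (P (X e @^-1` A) * P B)%E)) => //.
- exact: cylinders_off_setI.
- by rewrite setIT probability_setT mule1.
- by move=> B; exact: indep_cylinder.
- move=> B mB; apply: stepC; exact: (cylinders_off_measurable mB).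
- move=> F mF; apply: stepU => n; exact: (cylinders_off_measurable (mF n)).
Qed.

End Independence.
(** * Expectations of bounded functions *)
Section Expectation.
Context d {T : measurableType d} {R : realType} (P : probability T R).
Implicit Types g h : T -> R.

Definition Ex g : R := \int[P]_t g t.

Definition bmeas g := measurable_fun [set: T] g /\ exists B, forall t, `|g t| <= B.

Lemma bmeas_integrable g : bmeas g -> P.-integrable [set: T] (EFin \o g).
Proof.
move=> [mg [B gB]]; apply: measurable_bounded_integrable => //.
  by apply: (le_lt_trans (probability_le1 P measurableT)); exact: ltry.
exists B; split; first exact: num_real.
by move=> b Bb t _ /=; apply: le_trans (ltW Bb).
Qed.

Lemma bmeas_cst (c : R) : bmeas (fun=> c).
Proof. by split; [exact: measurable_cst|exists `|c|]. Qed.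

Lemma bmeasD g h : bmeas g -> bmeas h -> bmeas (fun t => g t + h t).
Proof.
move=> [mg [B gB]] [mh [C hC]]; split; first exact: measurable_funD.
by exists (B + C) => t; apply: le_trans (ler_normD _ _) _; exact: lerD.
Qed.

Lemma bmeasM g h : bmeas g -> bmeas h -> bmeas (fun t => g t * h t).
Proof.
move=> [mg [B gB]] [mh [C hC]]; split; first exact: measurable_funM.
by exists (B * C) => t; rewrite normrM; exact: ler_pM.
Qed.

Lemma bmeasN g : bmeas g -> bmeas (fun t => - g t).
Proof. by move=> [mg [B gB]]; split; [exact: measurableT_comp|exists B => t; rewrite normrN]. Qed.

Lemma bmeasB g h : bmeas g -> bmeas h -> bmeas (fun t => g t - h t).
Proof. by move=> bg bh; apply: bmeasD => //; exact: bmeasN. Qed.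

Lemma bmeas_norm g : bmeas g -> bmeas (fun t => `|g t|).
Proof.
move=> [mg [B gB]]; split; first exact: measurableT_comp.
by exists B => t; rewrite normr_id.
Qed.

Lemma bmeas_sum (I : Type) (s : seq I) (p : pred I) (g : I -> T -> R) :
  (forall i, bmeas (g i)) -> bmeas (fun t => \sum_(i <- s | p i) g i t).
Proof.
move=> bg; elim: s => [|i s IH].
  by under eq_fun do rewrite big_nil; exact: bmeas_cst.
under eq_fun do rewrite big_cons.
by case: (p i) => //; exact: bmeasD.
Qed.

Lemma Ex_cst c : Ex (fun=> c) = c.
Proof.
have h : fine (P [set: T]) = 1 by rewrite probability_setT.
by rewrite /Ex Rintegral_cst // [fine _]h mulr1.
Qed.

Lemma ExD g h : bmeas g -> bmeas h -> Ex (fun t => g t + h t) = Ex g + Ex h.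
Proof. by move=> bg bh; apply: RintegralD => //; exact: bmeas_integrable. Qed.

Lemma ExB g h : bmeas g -> bmeas h -> Ex (fun t => g t - h t) = Ex g - Ex h.
Proof. by move=> bg bh; apply: RintegralB => //; exact: bmeas_integrable. Qed.

Lemma ExZ c g : bmeas g -> Ex (fun t => c * g t) = c * Ex g.
Proof. by move=> bg; apply: RintegralZl => //; exact: bmeas_integrable. Qed.

Lemma le_Ex g h : bmeas g -> bmeas h -> (forall t, g t <= h t) -> Ex g <= Ex h.
Proof. by move=> bg bh gh; apply: le_Rintegral => //; exact: bmeas_integrable. Qed.

Lemma Ex_ge0 g : (forall t, 0 <= g t) -> 0 <= Ex g.
Proof. by move=> g0; exact: Rintegral_ge0. Qed.

Lemma eq_Ex g h : g =1 h -> Ex g = Ex h.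
Proof. by move=> gh; apply: eq_Rintegral => t _. Qed.

Lemma Ex_norm g : bmeas g -> `|Ex g| <= Ex (fun t => `|g t|).
Proof. by move=> bg; apply: le_normr_Rintegral => //; exact: bmeas_integrable. Qed.

Lemma Ex_sum (I : Type) (s : seq I) (p : pred I) (g : I -> T -> R) :
  (forall i, bmeas (g i)) ->
  Ex (fun t => \sum_(i <- s | p i) g i t) = \sum_(i <- s | p i) Ex (g i).
Proof.
move=> bg; elim: s => [|i s IH].
  by rewrite big_nil; under eq_Ex do rewrite big_nil; exact: Ex_cst.
rewrite big_cons -IH; under eq_Ex do rewrite big_cons.
by case: (p i) => //; apply: ExD => //; exact: bmeas_sum.
Qed.

Lemma bool_indic (b : T -> bool) : (fun t => (b t)%:R) = \1_[set t | b t] :> (T -> R).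
Proof.
apply/funext => t; rewrite indicE; have [bt|bt] := boolP (b t).
  by rewrite mem_set.
by rewrite memNset //=; exact/negP.
Qed.

Lemma bmeas_bool (b : T -> bool) : measurable [set t | b t] -> bmeas (fun t => (b t)%:R).
Proof.
move=> mb; have -> : (fun t => (b t)%:R) = \1_[set t | b t] :> (T -> R).
  exact: bool_indic.
split; first exact: measurable_indic.
by exists 1 => t; rewrite indicE; case: (_ \in _); rewrite ?normr1 ?normr0.
Qed.

Lemma Ex_bool (b : T -> bool) : measurable [set t | b t] ->
  Ex (fun t => (b t)%:R) = fine (P [set t | b t]).
Proof.
move=> mb; have -> : (fun t => (b t)%:R) = \1_[set t | b t] :> (T -> R).
  exact: bool_indic.
by rewrite /Ex /Rintegral integral_indic // setIT.
Qed.

Lemma bmeas_determined (K : Type) (k : T -> K) (c : K -> R) (B : R) :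
  (forall A : set K, measurable (k @^-1` A)) -> (forall t, `|c (k t)| <= B) ->
  bmeas (fun t => c (k t)).
Proof.
move=> mk cB; split; last by exists B.
by move=> _ A mA; rewrite setTI; exact: (mk (c @^-1` A)).
Qed.

End Expectation.

Section IndependentExpectation.
Context d {T : measurableType d} {R : realType} (P : probability T R).
Context {E : finType} (X : E -> {RV P >-> R}).
Hypothesis indep : mutually_independent P X.

(** [k] summarises the variables other than [X e]; as it takes finitely many
    values, the expectation of the product splits into probabilities of
    independent events. *)
Lemma Ex_indep (e : E) (b : T -> bool) (K : finType) (k : T -> K) (c : K -> R) :
  (exists2 A : set R, measurable A & [set t | b t] = X e @^-1` A) ->
  (forall x, <<s cylinders_off X e >> (k @^-1` [set x])) ->
  Ex P (fun t => (b t)%:R * c (k t)) = Ex P (fun t => (b t)%:R) * Ex P (fun t => c (k t)).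
Proof.
move=> [A mA bA] mk.
have mb : measurable [set t | b t].
  by rewrite bA -[X in measurable X]setTI; exact: (measurable_funPT (X e)).
have mkx x : measurable [set t | k t == x].
  rewrite (_ : [set t | k t == x] = k @^-1` [set x]); first exact: (cylinders_off_measurable (mk x)).
  by apply/seteqP; split=> t /= /eqP.
have ck (t : T) : c (k t) = \sum_x c x * (k t == x)%:R.
  rewrite (bigD1 (k t)) //= eqxx mulr1 big1 ?addr0 // => x.
  by rewrite eq_sym => /negbTE ->; rewrite mulr0.
have mbk x : measurable [set t | b t && (k t == x)].
  rewrite (_ : [set t | _] = [set t | b t] `&` [set t | k t == x]); first exact: measurableI.
  by apply/seteqP; split=> t /= /andP.
have e1 : Ex P (fun t => (b t)%:R * c (k t))
    = Ex P (fun t => \sum_x c x * (b t && (k t == x))%:R).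
  apply: eq_Ex => t; rewrite ck mulr_sumr; apply: eq_bigr => x _.
  by rewrite -mulnb natrM; ring.
rewrite e1 (eq_Ex P ck) !Ex_sum; try by move=> x; apply: bmeasM; [exact: bmeas_cst|exact: bmeas_bool].
rewrite mulr_sumr; apply: eq_bigr => x _.
rewrite !ExZ; try exact: bmeas_bool.
rewrite mulrCA; congr (_ * _); rewrite !Ex_bool // -fineM ?fin_num_measure //; congr fine.
rewrite (_ : [set t | _ && _] = (X e @^-1` A) `&` (k @^-1` [set x])); last first.
  by rewrite -bA; apply/seteqP; split=> t /=; [move=> /andP[-> /eqP]|move=> [-> ->] /=; rewrite eqxx].
rewrite (indep_off indep) // bA; congr (_ * P _)%E.
by apply/seteqP; split=> t /= /eqP.
Qed.

End IndependentExpectation.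
(** * Increments of the number of unmatched vertices *)
Section Generator.
Context d {T : measurableType d} {R : realType} (P : probability T R).
Context {n : nat} (X : edge n -> {RV P >-> R}) (F : R -> R).
Hypothesis indep : mutually_independent P X.
Hypothesis cdfX : forall e x, fine (P [set t | X e t <= x]) = F x.
Implicit Types (e : edge n) (x y : R).

Let w (t : T) : edge n -> R := fun e => X e t.

Lemma measurable_le e x : measurable [set t | X e t <= x].
Proof.
rewrite (_ : [set t | _] = X e @^-1` `]-oo, x]); last first.
  by apply/seteqP; split=> t; rewrite /= in_itv.
by rewrite -[X in measurable X]setTI; exact: measurable_funPT.
Qed.

Lemma measurable_window e x y : measurable [set t | window (w t) x y e].
Proof.
rewrite (_ : [set t | _] = X e @^-1` `]x, y]); last first.
  by apply/seteqP; split=> t; rewrite /= in_itv.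
by rewrite -[X in measurable X]setTI; exact: measurable_funPT.
Qed.

Lemma Ex_le e x : Ex P (fun t => (X e t <= x)%R%:R) = F x.
Proof. by rewrite Ex_bool ?cdfX //; exact: measurable_le. Qed.

Lemma Ex_gt e x : Ex P (fun t => (x < X e t)%R%:R) = 1 - F x.
Proof.
transitivity (Ex P (fun t => 1 - (X e t <= x)%R%:R)).
  by apply: eq_Ex => t; rewrite ltNge; case: (_ <= _); rewrite ?subrr ?subr0.
rewrite ExB ?Ex_cst ?Ex_le //; first exact: bmeas_cst.
by apply: bmeas_bool; exact: measurable_le.
Qed.

Lemma Ex_window e x y : x <= y -> Ex P (fun t => (window (w t) x y e)%:R) = F y - F x.
Proof.
move=> xy; rewrite -(Ex_le e x) -(Ex_le e y) -ExB; try by apply: bmeas_bool; exact: measurable_le.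
apply: eq_Ex => t; rewrite /window /w ltNge; case: (leP (X e t) x) => h /=.
  by rewrite (le_trans h xy) subrr.
by rewrite subr0.
Qed.

Lemma Ex_pair e g x y : x <= y -> e != g ->
  Ex P (fun t => (window (w t) x y e)%:R * (window (w t) x y g)%:R) = (F y - F x) ^+ 2.
Proof.
move=> xy eg; rewrite (@Ex_indep _ _ _ P _ X indep e _ bool (fun t => window (w t) x y g) (fun b => b%:R)).
- by rewrite !Ex_window // expr2.
- exists (`]x, y]%classic); first exact: measurable_itv.
  by apply/seteqP; split=> t; rewrite /= in_itv.
- move=> b; apply: sub_sigma_algebra.
  exists (fun h => if h == g then [set z | (x < z <= y) = b] else setT).
    move=> h; case: ifP => // _; case: b.
      by rewrite (_ : mkset _ = `]x, y]%classic) //; apply/seteqP; split=> z; rewrite /= in_itv.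
    rewrite (_ : mkset _ = ~` (`]x, y]%classic)); first by apply: measurableC; exact: measurable_itv.
    by apply/seteqP; split=> z; rewrite /= in_itv /=; [move=> ->|move=> /negP/negbTE].
  apply/seteqP; split=> t /=.
    by move=> tb h _ /=; case: eqP => [->|].
  by move=> h; have := h g; rewrite /= eqxx => h'; apply: h'; rewrite eq_sym.
Qed.

(** The cost of [e] is replaced by a value above [x], which the state at
    threshold [x] cannot distinguish from any other such value.  The new costs do
    not involve [X e]. *)
Definition w_off e x (t : T) : edge n -> R := fun f => if f == e then x + 1 else X f t.

Lemma level_off e x t : x < X e t -> level (w t) x = level (w_off e x t) x.
Proof.
move=> xe; have le f : (w t f <= x) = (w_off e x t f <= x).
  rewrite /w_off /w; case: eqP => [->|//].
  by rewrite !leNgt xe ltrDl ltr01.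
have eqw f : w t f <= x -> w_off e x t f = w t f.
  by rewrite /w_off; case: eqP => [->|//]; rewrite /w leNgt xe.
apply: eq_level => // f g fx gx.
by rewrite /edge_le /key !eqw.
Qed.

Let T' e := g_sigma_algebraType (cylinders_off X e).

Lemma measurable_off e x f : measurable_fun [set: T' e] (w_off e x ^~ f).
Proof.
rewrite /w_off; case: eqP => [_|/eqP fe]; first exact: measurable_cst.
move=> _ A mA; rewrite setTI; apply: sub_sigma_algebra.
exists (fun g => if g == f then A else setT); first by move=> g; case: ifP.
apply/seteqP; split=> t /=.
  by move=> tA g _ /=; case: eqP => [->|].
by move=> h; have := h f; rewrite /= eqxx => h'; exact: h'.
Qed.

(** The part of the state that [jump] depends on, with finitely many values. *)
Definition state e (v : edge n -> R) x : bool * 'I_n.+1 :=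
  (free (level v x) e, inord (nfree v x)).

Lemma eq_level_pattern (v v' : edge n -> R) x x' :
  (forall e f, (v e <= v f) = (v' e <= v' f)) -> (forall e, (v e <= x) = (v' e <= x')) ->
  level v x = level v' x'.
Proof.
move=> h1 h2; apply: eq_level => // e f _ _; exact: eq_edge_le.
Qed.

Lemma measurable_state_off e x (A : set (bool * 'I_n.+1)) :
  <<s cylinders_off X e >> ((fun t => state e (w_off e x t) x) @^-1` A).
Proof.
apply: (@measurable_pattern _ (T' e) R _ (fun f t => w_off e x t f) (fun=> x)) => //.
- exact: measurable_off.
- by move=> t t' h1 h2; rewrite /state /nfree (eq_level_pattern h1 h2).
Qed.

Lemma measurable_level x K (g : seq (edge n) -> K) (A : set K) :
  measurable ((fun t => g (level (w t) x)) @^-1` A).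
Proof.
apply: (@measurable_pattern _ T R _ (fun f t => X f t) (fun=> x)) => //.
by move=> t t' h1 h2; rewrite (eq_level_pattern h1 h2).
Qed.

Definition jump_of f (s : bool * 'I_n.+1) : R := s.1%:R * (f s.2.-1 - f s.2).

Lemma jumpE f e (v : edge n -> R) x : jump f v x e = jump_of f (state e v x).
Proof.
by rewrite /jump_of /state /= inordK // ltnS nfree_le.
Qed.

Lemma bmeas_fin (K : finType) (k : T -> K) (c : K -> R) :
  (forall A : set K, measurable (k @^-1` A)) -> bmeas (fun t => c (k t)).
Proof.
move=> mk; apply: (@bmeas_determined _ T R K k c (\sum_x `|c x|)) => // t.
by rewrite (bigD1 (k t)) //= lerDl sumr_ge0.
Qed.

Lemma bmeas_jump f e x : bmeas (fun t => jump f (w t) x e).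
Proof.
under eq_fun do rewrite jumpE.
apply: bmeas_fin => A.
exact: (measurable_level x (fun L => (free L e, inord (unmatched L))) A).
Qed.

Lemma bmeas_nfree (f : nat -> R) x : bmeas (fun t => f (nfree (w t) x)).
Proof.
have -> : (fun t => f (nfree (w t) x)) = (fun t => (fun k : 'I_n.+1 => f k) (inord (nfree (w t) x))).
  by apply/funext => t; rewrite inordK // ltnS nfree_le.
apply: (bmeas_fin (k := fun t => inord (nfree (w t) x) : 'I_n.+1) (fun k : 'I_n.+1 => f k)) => A.
exact: (measurable_level x (fun L => inord (unmatched L)) A).
Qed.

(** Where [X e > x] the jump is a function of the other costs; elsewhere it
    vanishes, as [e] is not free.  Given the other costs and that [X e > x], the
    cost of [e] is in the window with probability [(F y - F x) / (1 - F x)]. *)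
Lemma Ex_window_jump f e x y : x <= y ->
  (1 - F x) * Ex P (fun t => (window (w t) x y e)%:R * jump f (w t) x e)
  = (F y - F x) * Ex P (fun t => jump f (w t) x e).
Proof.
move=> xy; pose c t := jump_of f (state e (w_off e x t) x).
have offE t : x < X e t -> jump f (w t) x e = c t.
  by move=> xe; rewrite jumpE /c /state /nfree (level_off xe).
have bw (z : T -> bool) (A : set R) : measurable A -> [set t | z t] = X e @^-1` A ->
    Ex P (fun t => (z t)%:R * c t) = Ex P (fun t => (z t)%:R) * Ex P c.
  move=> mA zA; apply: (Ex_indep indep (e := e)); first by exists A.
  by move=> s; exact: measurable_state_off.
have -> : Ex P (fun t => (window (w t) x y e)%:R * jump f (w t) x e) = (F y - F x) * Ex P c.
  rewrite -(Ex_window e xy) -(bw _ (`]x, y]%classic)) //.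
  apply: eq_Ex => t; case: (boolP (window _ _ _ _)) => [/andP[xe _]|_]; last by rewrite !mul0r.
  by rewrite offE.
suff -> : Ex P (fun t => jump f (w t) x e) = (1 - F x) * Ex P c by ring.
rewrite -(Ex_gt e) -(bw _ (`]x, +oo[%classic)) //; last first.
  by apply/seteqP; split=> t; rewrite /= in_itv /= andbT.
apply: eq_Ex => t; case: (boolP (x < X e t)) => xe; first by rewrite mul1r offE.
rewrite mul0r /jump; case: (boolP (free _ _)) => [/level_free xe'|]; last by rewrite mul0r.
by rewrite /w in xe'; rewrite xe' in xe.
Qed.

Lemma sum_jump f x t : \sum_e jump f (w t) x e =
  (nfree (w t) x)%:R ^+ 2 * (f (nfree (w t) x).-1 - f (nfree (w t) x)).
Proof.
rewrite /jump -mulr_suml; congr (_ * _).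
rewrite -natrX -(card_free (level_matching (w t) x)) -sum1_card natr_sum.
rewrite [RHS]big_mkcond; apply: eq_bigr => e _; rewrite inE.
by case: (free _ _).
Qed.

(** Each of the [nfree ^ 2] free edges enters the window with the same
    probability, and two given edges are both in it with probability
    [(F y - F x)^2], which bounds the error of [generator_step]. *)
Lemma generator f (B : R) x y : x <= y -> F x < 1 ->
  (forall k, (k <= n)%N -> `|f k| <= B) ->
  `|Ex P (fun t => f (nfree (w t) y)) - Ex P (fun t => f (nfree (w t) x))
    - (F y - F x) / (1 - F x) *
      Ex P (fun t => (nfree (w t) x)%:R ^+ 2 * (f (nfree (w t) x).-1 - f (nfree (w t) x)))|
  <= 3 * B * (#|{: edge n}|%:R ^+ 2) * (F y - F x) ^+ 2.
Proof.
move=> xy Fx1 fB.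
have B0 : 0 <= B by apply: le_trans (fB 0%N _).
have F1 : 1 - F x != 0 by rewrite gt_eqF // subr_gt0.
have bW e : bmeas (fun t => (window (w t) x y e)%:R : R) by apply: bmeas_bool; exact: measurable_window.
have bWJ e : bmeas (fun t => (window (w t) x y e)%:R * jump f (w t) x e).
  by apply: bmeasM => //; exact: bmeas_jump.
have -> : (F y - F x) / (1 - F x) *
      Ex P (fun t => (nfree (w t) x)%:R ^+ 2 * (f (nfree (w t) x).-1 - f (nfree (w t) x)))
   = Ex P (fun t => \sum_e (window (w t) x y e)%:R * jump f (w t) x e).
  under eq_Ex do rewrite -sum_jump.
  rewrite !Ex_sum //; last by move=> e; exact: bmeas_jump.
  rewrite mulr_sumr; apply: eq_bigr => e _; apply: (mulfI F1).
  by rewrite Ex_window_jump //; field.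
rewrite -!ExB; try exact: bmeas_nfree; last 2 first.
- by apply: bmeasB; exact: bmeas_nfree.
- exact: bmeas_sum.
have bD : bmeas (fun t => f (nfree (w t) y) - f (nfree (w t) x) -
    \sum_e (window (w t) x y e)%:R * jump f (w t) x e).
  by apply: bmeasB; [apply: bmeasB; exact: bmeas_nfree|exact: bmeas_sum].
apply: (le_trans (Ex_norm P bD)).
have bp e g : bmeas (fun t => (window (w t) x y e)%:R * (window (w t) x y g)%:R : R) by exact: bmeasM.
have bS : bmeas (fun t => \sum_e \sum_(g | g != e)
    ((window (w t) x y e)%:R * (window (w t) x y g)%:R) : R).
  by apply: bmeas_sum => e; apply: bmeas_sum => g.
have bS3 := bmeasM (bmeas_cst (3 * B)) bS.
apply: (le_trans (le_Ex P (bmeas_norm bD) bS3 (fun t => generator_step (w t) xy fB))).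
rewrite ExZ //.
rewrite -!mulrA !ler_wpM2l // Ex_sum; last by move=> e; apply: bmeas_sum => g.
apply: (@le_trans _ _ (\sum_(e : edge n) \sum_(g : edge n) (F y - F x) ^+ 2)).
  apply: ler_sum => e _; rewrite Ex_sum //.
  rewrite [leRHS](bigD1 e) //= -[leLHS]add0r lerD ?sqr_ge0 //.
  by apply: ler_sum => g ge; rewrite Ex_pair // eq_sym.
have cE (c : R) : \sum_(e : edge n) c = #|{: edge n}|%:R * c.
  by rewrite sumr_const mulr_natl.
by rewrite !cE mulrA -expr2.
Qed.

End Generator.
(** * Moment bounds for the number of unmatched vertices *)
Section QuadraticError.
Context {R : realType} (F D : R -> R) (C a b : R).
Hypothesis cF : continuous F.
Hypothesis F_mono : {homo F : x y / x <= y}.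
Hypothesis C0 : 0 <= C.
Hypothesis D_step : forall x y, a <= x -> x <= y -> y <= b ->
  D x - C * (F y - F x) ^+ 2 <= D y.

(** Cutting an interval into two parts on which [F] increases equally halves the
    total quadratic error. *)
Lemma bisection k x y : a <= x -> x <= y -> y <= b ->
  D x - C * (F y - F x) ^+ 2 / 2 ^+ k <= D y.
Proof.
elim: k x y => [|k IH] x y ax xy yb; first by rewrite expr0 divr1; exact: D_step.
have Fxy := F_mono xy.
have [|m] := @IVT R F x y ((F x + F y) / 2) xy (continuous_subspaceT cF).
  rewrite (min_idPl Fxy) (max_idPr Fxy); apply/andP; split; lra.
rewrite in_itv /= => /andP[xm my] Fm.
have h1 := IH x m ax xm (le_trans my yb); have h2 := IH m y (le_trans ax xm) my yb.
have k0 : 2 ^+ k != 0 :> R by rewrite expf_neq0.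
have e : C * (F y - F x) ^+ 2 / 2 ^+ k.+1 = C * (F m - F x) ^+ 2 / 2 ^+ k + C * (F y - F m) ^+ 2 / 2 ^+ k.
  by rewrite Fm [2 ^+ k.+1]exprS; field.
rewrite e; lra.
Qed.

(** An inequality between increments that holds up to an error quadratic in the
    increment of [F] holds exactly.  It plays the part of a differential
    inequality with respect to [F]. *)
Lemma quadratic_error : a <= b -> D a <= D b.
Proof.
move=> ab; rewrite leNgt; apply/negP => lt.
pose K := C * (F b - F a) ^+ 2.
have e0 : 0 < D a - D b by rewrite subr_gt0.
have [k hk] : exists k : nat, K / (D a - D b) < k.+1%:R.
  by exists (Num.trunc (K / (D a - D b))); exact: truncnS_gt.
have := @bisection k.+1 a b (lexx _) ab (lexx _); rewrite -/K.
have h2 : k.+1%:R < 2 ^+ k.+1 :> R by rewrite -natrX ltr_nat ltn_expl.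
have p0 : 0 < 2 ^+ k.+1 :> R by rewrite exprn_gt0.
rewrite ltr_pdivrMr // in hk.
rewrite leNgt ltrBrDl -ltrBrDr ltr_pdivrMr // => /negP; apply.
by apply: (lt_trans hk); rewrite mulrC ltr_pM2l.
Qed.

End QuadraticError.

Section Moments.
Context d {T : measurableType d} {R : realType} (P : probability T R).
Context {n : nat} (X : edge n -> {RV P >-> R}) (F : R -> R).
Hypothesis indep : mutually_independent P X.
Hypothesis cdfX : forall e x, fine (P [set t | X e t <= x]) = F x.
Hypothesis cF : continuous F.
Hypothesis F_mono : {homo F : x y / x <= y}.
Hypothesis F0 : F 0 = 0.
Hypothesis n_gt0 : (0 < n)%N.

Let w (t : T) : edge n -> R := fun e => X e t.
Let N2 : R := #|{: edge n}|%:R ^+ 2.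
Let bU := @bmeas_nfree _ T R P n X.

Definition mean_free (x : R) : R := Ex P (fun t => (nfree (w t) x)%:R).
Definition mean_inv (x : R) : R := Ex P (fun t => ((nfree (w t) x).+1%:R)^-1).

Lemma nfree_mono t x y : x <= y -> (nfree (w t) y <= nfree (w t) x)%N.
Proof.
move=> xy; rewrite !nfree_count; apply: sub_count => e /=; exact: le_lt_trans.
Qed.

Lemma mean_free_ge0 x : 0 <= mean_free x.
Proof. exact: Ex_ge0. Qed.

Lemma mean_free_mono x y : x <= y -> mean_free y <= mean_free x.
Proof.
move=> xy; apply: le_Ex; try exact: (bU (fun k => k%:R)).
by move=> t; rewrite ler_nat nfree_mono.
Qed.

Lemma mean_free_le_n x : mean_free x <= n%:R.
Proof.
rewrite -(Ex_cst P n%:R); apply: le_Ex.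
- exact: (bU (fun k => k%:R)).
- exact: bmeas_cst.
- by move=> t; rewrite ler_nat nfree_le.
Qed.

Lemma F_ge0 x : 0 <= x -> 0 <= F x.
Proof. by move=> x0; have := F_mono x0; rewrite F0. Qed.

Lemma mean_free_sqr x : mean_free x ^+ 2 <= Ex P (fun t => (nfree (w t) x)%:R ^+ 2).
Proof.
set m := mean_free x.
have b1 := bU (fun k => k%:R) x; have b2 := bU (fun k => k%:R ^+ 2) x.
have h : 0 <= Ex P (fun t => ((nfree (w t) x)%:R ^+ 2 + m ^+ 2) - 2 * m * (nfree (w t) x)%:R).
  apply: Ex_ge0 => t; rewrite (_ : _ - _ = ((nfree (w t) x)%:R - m) ^+ 2); last by ring.
  exact: sqr_ge0.
rewrite ExB ?ExD ?ExZ ?Ex_cst // -/(mean_free x) -/m in h; first by lra.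
- exact: bmeas_cst.
- exact: bmeas_cst.
- by apply: bmeasD => //; exact: bmeas_cst.
- by apply: bmeasM => //; exact: bmeas_cst.
Qed.

Lemma mean_free_step x y : x <= y -> F x < 1 ->
  mean_free y <= mean_free x
    - (F y - F x) / (1 - F x) * Ex P (fun t => (nfree (w t) x)%:R ^+ 2)
    + 3 * n%:R * N2 * (F y - F x) ^+ 2.
Proof.
move=> xy Fx1.
have fB k : (k <= n)%N -> `|k%:R| <= n%:R :> R by rewrite normr_nat ler_nat.
have := @generator _ T R P n X F indep cdfX (fun k => k%:R) n%:R x y xy Fx1 fB.
rewrite -/(w _) => /ler_normlP[_]; rewrite -/(mean_free x) -/(mean_free y).
have -> : Ex P (fun t => (nfree (w t) x)%:R ^+ 2 * ((nfree (w t) x).-1%:R - (nfree (w t) x)%:R))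
   = - Ex P (fun t => (nfree (w t) x)%:R ^+ 2).
  rewrite -mulN1r -ExZ; last exact: (bU (fun k => k%:R ^+ 2)).
  apply: eq_Ex => t; case: (nfree _ _) => [|k]; first by rewrite expr0n mul0r mulr0.
  by rewrite -(natr1 k) /=; ring.
rewrite -/N2; lra.
Qed.

(** By [mean_free_step] and Jensen's inequality, [m = mean_free] satisfies
    [dm <= - m^2 dF], that is [d (1/m) >= dF]. *)
Lemma mean_free_upper x : 0 <= x -> F x < 1 -> mean_free x <= (n%:R^-1 + F x)^-1.
Proof.
move=> x0 Fx1.
have n0 : 0 < n%:R :> R by rewrite ltr0n.
have rhs0 : 0 < n%:R^-1 + F x by rewrite ltr_pwDl ?invr_gt0 // F_ge0.
have [->|m0] := eqVneq (mean_free x) 0; first by rewrite invr_ge0 ltW.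
have {}m0 : 0 < mean_free x by rewrite lt_neqAle eq_sym m0 mean_free_ge0.
rewrite -[leLHS]invrK lef_pV2 ?posrE ?invr_gt0 //.
set m := mean_free x in m0 *.
pose C := 3 * n%:R * N2.
have C0 : 0 <= C by rewrite !mulr_ge0 // exprn_ge0.
suff h : (mean_free 0)^-1 - F 0 <= (mean_free x)^-1 - F x.
  have m00 : 0 < mean_free 0 by apply: (lt_le_trans m0); exact: mean_free_mono.
  have : n%:R^-1 <= (mean_free 0)^-1 by rewrite lef_pV2 ?posrE // mean_free_le_n.
  by move: h; rewrite F0 -/m; lra.
apply: (@quadratic_error _ F (fun z => (mean_free z)^-1 - F z) (C / m ^+ 2)) => //.
move=> y z y0 yz zx.
have Fy1 : F y < 1 by apply: le_lt_trans Fx1; apply: F_mono; exact: le_trans zx.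
have st := mean_free_step yz Fy1; have sq := mean_free_sqr y.
have ab := mean_free_mono yz.
have am : m <= mean_free z by exact: mean_free_mono.
have Fyz := F_mono yz.
have Fy0 := F_ge0 y0.
rewrite -/C in st; set s := Ex _ _ in st sq.
set a := mean_free y in st sq ab *; set b := mean_free z in st ab am *.
set q := F z - F y in st *; have q0 : 0 <= q by rewrite subr_ge0.
have b0 : 0 < b by apply: lt_le_trans am.
have a0 : 0 < a by apply: lt_le_trans ab.
have qs : q * a ^+ 2 <= q / (1 - F y) * s.
  rewrite -mulrA ler_wpM2l //; apply: (le_trans sq).
  rewrite ler_pdivlMl ?subr_gt0 // ler_piMl //; first by apply: (le_trans _ sq); exact: sqr_ge0.
  by rewrite lerBlDr lerDl.
have d1 : q * a ^+ 2 - C * q ^+ 2 <= a - b by lra.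
have d2 : q - C / m ^+ 2 * q ^+ 2 <= b^-1 - a^-1.
  have -> : b^-1 - a^-1 = (a - b) / (a * b) by field; rewrite !gt_eqF.
  apply: (@le_trans _ _ ((q * a ^+ 2 - C * q ^+ 2) / (a * b))); last first.
    by rewrite ler_wpM2r // invr_ge0 mulr_ge0 // ltW.
  rewrite mulrBl; apply: lerB.
    by rewrite ler_pdivlMr ?mulr_gt0 // ler_wpM2l // expr2 ler_wpM2l // ltW.
  rewrite [leRHS]mulrAC ler_wpM2l ?mulr_ge0 ?sqr_ge0 //.
  rewrite lef_pV2 ?posrE ?exprn_gt0 ?mulr_gt0 // expr2.
  by rewrite ler_pM ?(ltW m0) // (le_trans am).
have qE : F z = F y + q by rewrite /q; ring.
by rewrite qE; move: (q) d2 => r; lra.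
Qed.

Lemma mean_inv0 : mean_inv 0 <= n.+1%:R^-1.
Proof.
have bw e : bmeas (fun t => (X e t <= 0)%R%:R : R).
  by apply: bmeas_bool; exact: measurable_le.
apply: (@le_trans _ _ (Ex P (fun t => n.+1%:R^-1 + \sum_e (X e t <= 0)%R%:R))).
  apply: le_Ex.
  - exact: (bU (fun k => k.+1%:R^-1)).
  - by apply: bmeasD; [exact: bmeas_cst|exact: bmeas_sum].
  move=> t; have [/existsP[e Xe]|/existsPn h] := boolP [exists e, X e t <= 0].
    rewrite (bigD1 e) //= Xe addrCA; apply: (@le_trans _ _ 1).
      by rewrite invf_le1 ?ltr0n // ler1n.
    by rewrite lerDl addr_ge0 ?invr_ge0 // sumr_ge0.
  have -> : nfree (w t) 0 = n.
    rewrite /nfree /level (_ : [seq _ <- _ | _] = [::]) /unmatched /= ?subn0 //.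
    by apply/eqP; rewrite -(negbK (_ == _)) -has_filter; apply/hasPn => e _; exact: h.
  by rewrite lerDl sumr_ge0.
rewrite ExD; [|exact: bmeas_cst|exact: bmeas_sum].
rewrite Ex_cst Ex_sum // big1 ?addr0 // => e _.
by rewrite (Ex_le cdfX).
Qed.

(** Since [k^2 (1/k - 1/(k+1)) = k/(k+1) <= 1], the mean of [1/(k+1)] grows at
    most at rate [dF / (1 - F)].  Together with [mean_free_upper] this leaves no
    room for fluctuations. *)
Lemma mean_inv_upper x0 x : 0 <= x -> x <= x0 -> F x0 < 1 ->
  mean_inv x <= n.+1%:R^-1 + F x / (1 - F x0).
Proof.
move=> x_ge0 xx0 Fx0.
pose C := 3 * 1 * N2 : R.
have C0 : 0 <= C by rewrite !mulr_ge0 // exprn_ge0.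
suff h : F 0 / (1 - F x0) - mean_inv 0 <= F x / (1 - F x0) - mean_inv x.
  have := mean_inv0; rewrite F0 mul0r in h.
  by move: h; move: (F x / _) (n.+1%:R^-1) (mean_inv 0) (mean_inv x) => r1 r2 r3 r4; lra.
apply: (@quadratic_error _ F (fun z => F z / (1 - F x0) - mean_inv z) C 0 x) => //.
move=> y z y0 yz zx.
have Fyx : F y <= F x0 by apply: F_mono; exact: le_trans (le_trans yz zx) xx0.
have Fy1 : F y < 1 by exact: le_lt_trans Fx0.
have fB k : (k <= n)%N -> `|k.+1%:R^-1| <= 1 :> R.
  by move=> _; rewrite ger0_norm ?invr_ge0 // invf_le1 ?ltr0n // ler1n.
have := @generator _ T R P n X F indep cdfX (fun k => k.+1%:R^-1) 1 y z yz Fy1 fB.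
rewrite -/(w _) => /ler_normlP[_]; rewrite -/(mean_inv y) -/(mean_inv z) -/N2 -/C.
set s := Ex _ _; set q := F z - F y.
have q0 : 0 <= q by rewrite subr_ge0; exact: F_mono.
have s1 : s <= 1.
  rewrite -(Ex_cst P 1); apply: le_Ex.
  - exact: (bU (fun k => k%:R ^+ 2 * (k.-1.+1%:R^-1 - k.+1%:R^-1))).
  - exact: bmeas_cst.
  move=> t; case: (nfree _ _) => [|k] /=; first by rewrite expr0n mul0r.
  rewrite -(natr1 k.+1); have k0 : 0 < k.+1%:R :> R by rewrite ltr0n.
  set u : R := k.+1%:R in k0 *.
  rewrite (_ : _ * _ = u / (u + 1)); last by field; rewrite !gt_eqF // addr_gt0.
  by rewrite ler_pdivrMr ?addr_gt0 // mul1r lerDl.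
have : q / (1 - F y) * s <= q / (1 - F x0).
  apply: (@le_trans _ _ (q / (1 - F y))).
    by rewrite ler_piMr // divr_ge0 // subr_ge0 ltW.
  by rewrite ler_wpM2l // lef_pV2 ?posrE ?subr_gt0 // lerD2l lerN2.
have qE : F z = F y + q by rewrite /q; ring.
by rewrite qE mulrDl; move: (q) => r; lra.
Qed.

Lemma mean_free_le_gt y : mean_free y <= \sum_(e : edge n) (1 - F y).
Proof.
have bw e : bmeas (fun t => (y < X e t)%R%:R : R).
  apply: bmeas_bool; rewrite (_ : [set t | _] = X e @^-1` `]y, +oo[).
    by rewrite -[X in measurable X]setTI; exact: measurable_funPT.
  by apply/seteqP; split=> t; rewrite /= in_itv /= andbT.
have -> : \sum_(e : edge n) (1 - F y) = Ex P (fun t => \sum_e (y < X e t)%R%:R).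
  by rewrite Ex_sum //; apply: eq_bigr => e _; rewrite (Ex_gt cdfX).
apply: le_Ex; [exact: (bU (fun k => k%:R))|exact: bmeas_sum|].
move=> t; apply: (@le_trans _ _ ((nfree (w t) y ^ 2)%N%:R)).
  by rewrite ler_nat; case: (nfree _ _) => // k; rewrite -{1}(expn1 k.+1) leq_pexp2l.
rewrite /nfree -(card_free (level_matching (w t) y)) -sum1_card natr_sum big_mkcond /=.
apply: ler_sum => e _; rewrite inE; case: ifP => // /level_free.
by rewrite /w => ->.
Qed.

(** Since [k^2 >= k], the quotient [mean_free / (1 - F)] does not increase. *)
Lemma mean_free_tail x0 y : 0 <= x0 -> x0 <= y -> F x0 < 1 ->
  mean_free y <= mean_free x0 / (1 - F x0) * (1 - F y).
Proof.
move=> x00 x0y Fx0; have Fy1 : F y <= 1.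
  by rewrite -subr_ge0 -(Ex_gt cdfX (Ordinal n_gt0, Ordinal n_gt0)); exact: Ex_ge0.
have [Fy|Fy] := eqVneq (F y) 1.
  (* the quotient makes no sense at [y], but no edge costs more than [y] *)
  apply: (le_trans (mean_free_le_gt y)).
  by rewrite Fy subrr mulr0 sumr_const mul0rn.
have {Fy Fy1}Fy1 : F y < 1 by rewrite lt_neqAle Fy.
rewrite -ler_pdivrMr ?subr_gt0 //.
pose C := 3 * n%:R * N2.
have C0 : 0 <= C by rewrite !mulr_ge0 // exprn_ge0.
rewrite -lerN2.
apply: (@quadratic_error _ F (fun z => - (mean_free z / (1 - F z))) (C / (1 - F y)) x0 y) => //.
move=> z v xz zv vy.
have Fvy : F v <= F y by exact: F_mono.
have Fv1 : F v < 1 by apply: le_lt_trans Fy1.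
have Fzv : F z <= F v by exact: F_mono.
have Fz1 : F z < 1 by exact: le_lt_trans Fv1.
have st := mean_free_step zv Fz1.
have sq : mean_free z <= Ex P (fun t => (nfree (w t) z)%:R ^+ 2).
  apply: le_Ex; [exact: (bU (fun k => k%:R))|exact: (bU (fun k => k%:R ^+ 2))|].
  by move=> t; rewrite -natrX ler_nat; case: (nfree _ _) => // k; rewrite -{1}(expn1 k.+1) leq_pexp2l.
rewrite -/C in st; set s := Ex _ _ in st sq.
set a := mean_free z in st sq *; set b := mean_free v in st *.
set q := F v - F z in st *; have q0 : 0 <= q by rewrite subr_ge0.
have z1 : 0 < 1 - F z by rewrite subr_gt0.
have v1 : 0 < 1 - F v by rewrite subr_gt0.
have y1 : 0 < 1 - F y by rewrite subr_gt0.
have qs : q / (1 - F z) * a <= q / (1 - F z) * s.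
  by rewrite ler_wpM2l // divr_ge0 // ltW.
have b1 : b <= a * (1 - F v) / (1 - F z) + C * q ^+ 2.
  have -> : a * (1 - F v) / (1 - F z) = a - q / (1 - F z) * a.
    by rewrite /q; field; rewrite gt_eqF.
  by move: st qs; lra.
have b2 : b / (1 - F v) <= a / (1 - F z) + C / (1 - F y) * q ^+ 2.
  rewrite ler_pdivrMr // mulrDl; apply: (le_trans b1); apply: lerD.
    by rewrite mulrAC.
  rewrite (_ : C / _ * _ * _ = C * q ^+ 2 * ((1 - F v) / (1 - F y))); last by ring.
  by rewrite ler_peMr ?mulr_ge0 ?sqr_ge0 // ler_pdivlMr // mul1r lerD2l lerN2.
by rewrite -opprD lerN2.
Qed.

(** For [V = nfree + 1], [2 |V - c| <= th V + (V - c)^2 / (th V)], and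
    [(V - c)^2 / V = V - 2 c + c^2 / V] is small in mean as soon as the means of
    [V] and of [1 / V] are close to [c] and to [1 / c]. *)
Lemma mean_dist x c th : 0 < c -> 0 < th -> th ^+ 2 <= 1 / 2 ->
  mean_free x <= c * (1 + 2 * th ^+ 2) -> mean_inv x <= (1 + th ^+ 2) / c ->
  Ex P (fun t => `|(nfree (w t) x)%:R - c|) <= 1 + (th + th^-1 + 5 * th * c) / 2.
Proof.
move=> c0 th0 th2 hu hv.
set V := fun t => ((nfree (w t) x).+1%:R)^-1 : R.
set U := fun t => (nfree (w t) x)%:R : R.
have bUx : bmeas U by exact: (bU (fun k => k%:R)).
have bV : bmeas V by exact: (bU (fun k => k.+1%:R^-1)).
pose a0 := 1 + (th + (1 - 2 * c) / th) / 2.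
pose a1 := (th + th^-1) / 2; pose a2 := c ^+ 2 / th / 2.
have pw t : `|U t - c| <= a0 + (a1 * U t + a2 * V t).
  have X0 : 0 < (nfree (w t) x).+1%:R :> R by rewrite ltr0n.
  have XE : (nfree (w t) x).+1%:R = U t + 1 :> R by rewrite natr1.
  rewrite /V XE in X0 *; set X' := U t + 1 in X0 *.
  have -> : a0 + (a1 * U t + a2 * X'^-1) = 1 + (th * X' + (X' - c) ^+ 2 / X' / th) / 2.
    by rewrite /a0 /a1 /a2 (_ : U t = X' - 1); [field; rewrite !gt_eqF|rewrite /X'; ring].
  apply: (@le_trans _ _ (1 + `|X' - c|)).
    rewrite (_ : U t - c = -1 + (X' - c)); last by rewrite /X'; ring.
    by apply: (le_trans (ler_normD _ _)); rewrite normrN1.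
  rewrite lerD2l ler_pdivlMr //.
  set y := `|X' - c|; have -> : (X' - c) ^+ 2 = y ^+ 2 by rewrite real_normK ?num_real.
  rewrite -subr_ge0 (_ : _ - _ = (th * X' - y) ^+ 2 / (X' * th)); last by field; rewrite !gt_eqF.
  by rewrite divr_ge0 ?sqr_ge0 // mulr_ge0 // ltW.
have b1 : bmeas (fun t => a1 * U t) by apply: bmeasM => //; exact: bmeas_cst.
have b2 : bmeas (fun t => a2 * V t) by apply: bmeasM => //; exact: bmeas_cst.
apply: (le_trans (le_Ex P _ _ pw)).
- by apply: bmeas_norm; apply: bmeasB => //; exact: bmeas_cst.
- by apply: bmeasD; [exact: bmeas_cst|exact: bmeasD].
rewrite (ExD P (bmeas_cst a0) (bmeasD b1 b2)) (ExD P b1 b2) (ExZ P a1 bUx) (ExZ P a2 bV).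
rewrite Ex_cst -/(mean_free x) -/(mean_inv x).
have th0' := ltW th0.
have a10 : 0 <= a1 by rewrite divr_ge0 // addr_ge0 // invr_ge0.
have a20 : 0 <= a2 by rewrite !divr_ge0 // sqr_ge0.
apply: (@le_trans _ _ (a0 + (a1 * (c * (1 + 2 * th ^+ 2)) + a2 * ((1 + th ^+ 2) / c)))).
  by rewrite lerD2l lerD // ler_wpM2l.
rewrite -subr_ge0 /a0 /a1 /a2.
rewrite (_ : _ - _ = th * c * (1 / 2 - th ^+ 2)); last by field; rewrite !gt_eqF.
by rewrite mulr_ge0 ?subr_ge0 // mulr_ge0 // ltW.
Qed.

Lemma measurable_tie e g x : measurable [set t | (X e t == X g t) && (X e t <= x)].
Proof.
apply: (@measurable_pattern _ T R _ (fun f t => X f t) (fun=> x) bool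
  (fun t => (X e t == X g t) && (X e t <= x)) [set true]) => //.
by move=> t t' h1 h2; rewrite !eq_le !h1 h2.
Qed.

(** A tie between [e] and [g] within a window has probability at most the square of
    the increment of [F], so that ties below [b] do not accumulate. *)
Lemma tie_null e g b : e != g -> 0 <= b ->
  P [set t | (X e t == X g t) && (X e t <= b)] = 0%E.
Proof.
move=> eg b0.
have mt := measurable_tie e g.
pose tie x := Ex P (fun t => ((X e t == X g t) && (X e t <= x))%R%:R).
suff t0 : tie b <= 0.
  apply/eqP; rewrite -(fineK (fin_num_measure P _ (mt b))) eqe eq_le -Ex_bool //.
  by rewrite [X in X && _]t0 Ex_ge0.
have t00 : tie 0 <= 0.
  rewrite -[leRHS]F0 -(Ex_le cdfX e); apply: le_Ex.
  - exact: bmeas_bool.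
  - by apply: bmeas_bool; exact: measurable_le.
  - by move=> t; case: (_ == _).
apply: (le_trans _ t00); rewrite -lerN2.
apply: (@quadratic_error _ F (fun x => - tie x) 1) => // x y x0 xy yb.
rewrite mul1r -(Ex_pair indep cdfX xy eg) lerBlDr addrC -lerBlDr opprK addrC -ExB; try exact: bmeas_bool.
apply: le_Ex.
- by apply: bmeasB; exact: bmeas_bool.
- by apply: bmeasM; apply: bmeas_bool; exact: measurable_window.
move=> t; rewrite /window; case: eqP => /= [<-|_]; last by rewrite subrr.
case: (leP (X e t) x) => h; first by rewrite (le_trans h xy) subrr.
by case: (X e t <= y) => /=; rewrite ?mulr1n ?mulr0n subr0 ?mulr1 ?mulr0.
Qed.

Lemma ae_generic : {ae P, forall t, injective (w t) /\ forall e, 0 < X e t}.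
Proof.
pose Z1 (p : edge n * edge n) (k : nat) :=
  [set t | [&& p.1 != p.2, X p.1 t == X p.2 t & X p.1 t <= k%:R]].
have n1 p k : P.-negligible (Z1 p k).
  have [pp|pp] := eqVneq p.1 p.2.
    by apply: negligibleS (negligible_set0 P) => t; rewrite /Z1 /= pp eqxx.
  exists [set t | (X p.1 t == X p.2 t) && (X p.1 t <= k%:R)]; split.
  - exact: measurable_tie.
  - exact: tie_null.
  - by move=> t /= /and3P[_ -> ->].
have n2 e : P.-negligible [set t | X e t <= 0].
  exists [set t | X e t <= 0]; split => //; first exact: measurable_le.
  by rewrite -(fineK (fin_num_measure P _ (measurable_le X e 0))) cdfX F0.
(* the bound [k] makes [tie_null] applicable: countably many null events *)
pose Z m := match unpickle m : option ((edge n * edge n) * nat) with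
  | Some q => Z1 q.1 q.2 `|` [set t | X q.1.1 t <= 0] | None => set0 end.
have nZ : P.-negligible (\bigcup_m Z m).
  apply: negligible_bigcup => m; rewrite /Z; case: unpickle => [q|].
    by apply: negligibleU; [exact: n1|exact: n2].
  exact: negligible_set0.
apply: negligibleS nZ => t /= ht; apply: contrapT => hZ; apply: ht.
have out e g k : ~ Z1 (e, g) k t /\ ~ X e t <= 0.
  have ZE : Z (pickle ((e, g), k)) = Z1 (e, g) k `|` [set t | X e t <= 0].
    by rewrite /Z pickleK.
  move: (pickle _) ZE => m ZE.
  by split=> h; apply: hZ; exists m; rewrite ?ZE; [|left| |right].
split=> [e g eg|e]; last by rewrite ltNge; apply/negP; exact: (out e e 0%N).2.
apply/eqP/negPn/negP => neg.
apply: (out e g (Num.trunc (X e t)).+1).1; rewrite /Z1 /= neg /=.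
by move: eg; rewrite /w => ->; rewrite eqxx /= ltW // truncnS_gt.
Qed.

End Moments.
(** * The cost as an integral of the number of unmatched vertices *)
Section CostL1.
Context d {T : measurableType d} {R : realType} (P : probability T R).
Context {n : nat} (X : edge n -> {RV P >-> R}).
Notation mu := (@lebesgue_measure R).
Hypothesis generic : {ae P, forall t, injective (fun e => X e t) /\ forall e, 0 < X e t}.

Let w (t : T) : edge n -> R := fun e => X e t.

Lemma EFin_Ex (g : T -> R) : bmeas g -> (\int[P]_t (g t)%:E)%E = (Ex P g)%:E.
Proof.
by move=> bg; rewrite /Ex /Rintegral fineK //; apply: integrable_fin_num => //; exact: bmeas_integrable.
Qed.

Lemma integral_lt (a : R) : 0 <= a ->
  (\int[mu]_(x in `[0%R, +oo[) ((x < a)%R%:R)%:E = a%:E)%E.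
Proof.
move=> a0; rewrite [X in (integral _ _ X = _)%E](_ : _ = EFin \o \1_(`]-oo, a[ : set R)); last first.
  apply/funext => x /=; congr EFin; rewrite indicE; congr (_%:R).
  by rewrite mem_setE in_itv.
rewrite integral_indic // (_ : _ `&` _ = `[0, a[%classic); last first.
  by apply/seteqP; split=> x; rewrite /= !in_itv /= andbT; [move=> [-> ->]|move=> /andP[]].
apply: (eq_trans (lebesgue_measure_itv (`[0, a[%R : interval R))).
rewrite /= lte_fin; case: ltP => [_|a0'].
  by rewrite oppr0 adde0.
by congr EFin; apply/eqP; rewrite eq_le a0 a0'.
Qed.

(** An edge of the matching of cost [a] contributes the integral of the
    indicator of [x < a]; see [nfree_count]. *)
Lemma cost_integral t : (forall e, 0 < X e t) ->
  (\int[mu]_(x in `[0%R, +oo[) ((nfree (w t) x)%:R)%:E =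
   (\sum_(e <- matched (w t)) X e t)%:E)%E.
Proof.
move=> X0.
transitivity (\int[mu]_(x in `[0%R, +oo[) (\sum_(e <- matched (w t)) ((x < X e t)%R%:R)%:E))%E.
  apply: eq_integral => x _; rewrite nfree_count -sum1_count natr_sum -sumEFin big_mkcond /=.
  by apply: eq_bigr => e _; case: (_ < _).
rewrite ge0_integral_sum //; last first.
  move=> e; apply/measurable_EFinP; apply: measurable_funTS.
  rewrite bool_indic.
  by apply: measurable_indic; rewrite (_ : [set x | _] = `]-oo, (X e t)[%classic).
rewrite -sumEFin; apply: eq_bigr => e _; apply: integral_lt; exact: ltW.
Qed.

Lemma measurable_nfree_pair :
  measurable_fun [set: T * R] (fun p : T * R => (nfree (w p.1) p.2)%:R : R).
Proof.
move=> _ A mA; rewrite setTI.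
apply: (@measurable_pattern _ (T * R)%type R _ (fun e p => X e p.1) snd _
  (fun p => (nfree (w p.1) p.2)%:R : R) A) => //.
- by move=> e; apply: measurableT_comp.
- by move=> p p' h1 h2; rewrite /nfree (eq_level_pattern h1 h2).
Qed.

Lemma measurable_stable_cost : measurable_fun [set: T] (fun t => stable_cost (w t)).
Proof.
have -> : (fun t => stable_cost (w t)) =
    (fun t => \sum_(e : edge n) (e \in stable_matching (w t))%:R * X e t).
  apply/funext => t; rewrite /stable_cost big_mkcond; apply: eq_bigr => e _.
  by case: (_ \in _); rewrite ?mul1r ?mul0r.
apply: measurable_sum => e; apply: measurable_funM => //.
rewrite bool_indic; apply: measurable_indic.
apply: (@measurable_pattern _ T R _ (fun e t => X e t) (fun=> 0) bool
  (fun t => e \in stable_matching (w t)) [set true]) => //.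
by move=> t t' h1 _; rewrite (@eq_stable_matching _ _ (w t) (w t')).
Qed.

Context (c B : R -> R) (x0 tl : R).
Hypothesis x0_gt0 : 0 < x0.
Hypothesis cc : continuous c.
Hypothesis c_ge0 : forall x, 0 <= c x.
Hypothesis cB : continuous B.
Hypothesis distB : forall x, 0 <= x <= x0 -> Ex P (fun t => `|(nfree (w t) x)%:R - c x|) <= B x.
Hypothesis tailB : (\int[mu]_(x in `]x0, +oo[) (Ex P (fun t => (nfree (w t) x)%:R))%:E <= tl%:E)%E.

(* [c] is cut off at [x0], so that beyond [x0] all of [nfree] counts as error. *)
Let ct x : R := (x <= x0)%R%:R * c x.
Let g t x : R := `|(nfree (w t) x)%:R - ct x|.

Let mct : measurable_fun [set: R] ct.
Proof.
apply: measurable_funM; last exact: continuous_measurable_fun.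
rewrite bool_indic; apply: measurable_indic.
by rewrite (_ : [set x | _] = `]-oo, x0]%classic).
Qed.

Let mnfree t : measurable_fun [set: R] (fun x => (nfree (w t) x)%:R : R).
Proof. exact: (measurable_fun_pair2 _ measurable_nfree_pair). Qed.

Lemma int_ct : (\int[mu]_(x in `[0%R, +oo[) (ct x)%:E = (prim c x0)%:E)%E.
Proof.
rewrite /prim /Rintegral fineK; last first.
  by apply: integrable_fin_num => //; exact: continuous_integrable.
rewrite -[`[0, x0]%classic](@setIidr _ `[0, +oo[%classic); last first.
  by move=> x /=; rewrite !in_itv /= => /andP[->].
rewrite integral_mkcondr; apply: eq_integral => x; rewrite inE /= in_itv /= andbT => x_ge0.
rewrite patchE /ct mem_setE in_itv /= x_ge0 /=.
by case: (x <= x0); rewrite ?mul1r ?mul0r.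
Qed.

Lemma cost_dist t : injective (w t) -> (forall e, 0 < X e t) ->
  ((`|stable_cost (w t) - prim c x0|)%:E <= \int[mu]_(x in `[0%R, +oo[) (g t x)%:E)%E.
Proof.
move=> wi X0; rewrite (stable_cost_matched wi).
have i1 := cost_integral X0.
have int1 : mu.-integrable `[0%R, +oo[ (fun x => ((nfree (w t) x)%:R)%:E).
  apply/integrableP; split; first by apply/measurable_EFinP; apply: measurable_funTS; exact: mnfree.
  under eq_integral do rewrite gee0_abs ?lee_fin //.
  by rewrite i1 ltry.
have int2 : mu.-integrable `[0%R, +oo[ (fun x => (ct x)%:E).
  apply/integrableP; split; first by apply/measurable_EFinP; apply: measurable_funTS; exact: mct.
  under eq_integral do rewrite gee0_abs ?lee_fin ?mulr_ge0 //.
  by rewrite int_ct ltry.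
rewrite -abse_EFin EFinB -i1 -int_ct -integralB_EFin //.
apply: (le_trans (le_abse_integral _ _ _)) => //.
apply/measurable_EFinP; apply: measurable_funTS.
by apply: measurable_funB; [exact: mnfree|exact: mct].
Qed.

Let G (p : T * R) : \bar R := (g p.1 p.2)%:E.
Let D : set R := `[0, +oo[%classic.

Let mg : measurable_fun [set: T * R] (fun p => g p.1 p.2).
Proof.
apply: measurableT_comp => //; apply: measurable_funB; first exact: measurable_nfree_pair.
by apply: (measurableT_comp mct); exact: measurable_snd.
Qed.

Let GD (p : T * R) : \bar R := ((p.2 \in D)%:R * g p.1 p.2)%:E.

Let mGD : measurable_fun [set: T * R] GD.
Proof.
apply/measurable_EFinP; apply: measurable_funM; last exact: mg.
rewrite bool_indic; apply: measurable_indic.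
rewrite (_ : [set t | _] = setT `&` (snd @^-1` D)).
  by apply: (measurable_snd measurableT); exact: measurable_itv.
by apply/seteqP; split=> p; rewrite /= inE //= => -[].
Qed.

Let GD_ge0 p : (0 <= GD p)%E.
Proof. by rewrite lee_fin; apply: mulr_ge0; [exact: ler0n|exact: normr_ge0]. Qed.

Let GD_int t : (\int[mu]_(x in D) (g t x)%:E = \int[mu]_x GD (t, x))%E.
Proof.
rewrite integral_mkcond; apply: eq_integral => x _.
by rewrite patchE /GD /=; case: (_ \in _); rewrite ?mul1r ?mul0r.
Qed.

Let bg x : bmeas (fun t => g t x).
Proof.
apply: bmeas_norm; apply: bmeasB; first exact: (@bmeas_nfree _ T R P n X (fun k => k%:R)).
exact: bmeas_cst.
Qed.

(** Tonelli: the error on the cost is at most the integral of the errors on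
    [nfree]. *)
Lemma cost_L1 :
  (\int[P]_t (`|stable_cost (w t) - prim c x0|)%:E <= (prim B x0 + tl)%:E)%E.
Proof.
apply: (@le_trans _ _ (\int[P]_t \int[mu]_x GD (t, x)))%E.
  apply: ae_ge0_le_integral => //.
  - apply/measurable_EFinP; apply: measurableT_comp => //.
    by apply: measurable_funB => //; exact: measurable_stable_cost.
  - by move=> t _; apply: integral_ge0.
  - exact: measurable_fun_fubini_tonelli_F.
  - apply: filterS generic => t [wi X0] _; rewrite -GD_int.
    exact: cost_dist.
rewrite fubini_tonelli //.
have -> : (\int[mu]_x \int[P]_t GD (t, x) = \int[mu]_(x in D) (Ex P (fun t => g t x))%:E)%E.
  rewrite [RHS]integral_mkcond; apply: eq_integral => x _; rewrite patchE /GD /=.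
  case: (_ \in _).
    by rewrite -EFin_Ex //; apply: eq_integral => t _; rewrite mul1r.
  by under eq_integral do rewrite mul0r; rewrite integral0.
have DE : D = `[0, x0]%classic `|` `]x0, +oo[%classic.
  apply/seteqP; split=> x; rewrite /D /= !in_itv /= !andbT.
    by move=> x_ge0; case: (leP x x0) => h; [left|right] => //; rewrite x_ge0.
  by case=> [/andP[]//|h]; apply: le_trans (ltW x0_gt0) (ltW h).
have mE : measurable_fun [set: R] (fun x => (Ex P (fun t => g t x))%:E).
  have -> : (fun x => (Ex P (fun t => g t x))%:E) = (fun x => \int[P]_t (g t x)%:E)%E.
    by apply/funext => x; rewrite EFin_Ex.
  have mG : measurable_fun [set: T * R] G by apply/measurable_EFinP; exact: mg.
  have G0 (p : T * R) : (0 <= G p)%E by rewrite lee_fin; exact: normr_ge0.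
  exact: (measurable_fun_fubini_tonelli_G (m1 := P) G mG G0).
rewrite DE ge0_integral_setU //; last 3 first.
- exact: measurable_funTS.
- by move=> x _; rewrite lee_fin; apply: Ex_ge0 => t; exact: normr_ge0.
- apply/disj_set2P; apply/seteqP; split=> x //=; rewrite !in_itv /= andbT.
  by move=> [/andP[_ h]]; rewrite ltNge h.
rewrite EFinD; apply: leeD.
  rewrite /prim /Rintegral fineK; last first.
    by apply: integrable_fin_num => //; exact: continuous_integrable.
  apply: ge0_le_integral => //.
  - by move=> x _; rewrite lee_fin; apply: Ex_ge0 => t; exact: normr_ge0.
  - exact: measurable_funTS.
  - by apply/measurable_EFinP; apply: measurable_funTS; exact: continuous_measurable_fun.
  move=> x /=; rewrite in_itv /= => hx; rewrite lee_fin; apply: le_trans (distB hx).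
  by rewrite le_eqVlt; apply/orP; left; apply/eqP; apply: eq_Ex => t; case/andP: hx => _ hx; rewrite /g /ct hx mul1r.
apply: le_trans tailB; rewrite le_eqVlt; apply/orP; left; apply/eqP.
apply: eq_integral => x; rewrite inE /= in_itv /= andbT => hx; congr EFin.
by apply: eq_Ex => t; rewrite /g /ct leNgt hx mul0r subr0 ger0_norm.
Qed.

End CostL1.
(** * The distribution function near 0 and at infinity *)

Lemma integral_le_inv_sqr {R : realType} (a k : R) (g : R -> R) : 0 < a -> 0 <= k ->
  measurable_fun [set: R] g -> (forall y, 0 <= g y) -> (forall y, a < y -> g y <= k / y ^+ 2) ->
  (\int[@lebesgue_measure R]_(y in `]a, +oo[) (g y)%:E <= (k / a)%:E)%E.
Proof.
move=> a0 k0 mg g0 gk; pose f (y : R) : R := k / y ^+ 2; pose W (y : R) : R := - k * y^-1.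
have dW (y : R) : 0 < y -> is_derive y 1 W (f y).
  move=> y0; have h : is_derive y 1 (fun z : R => z^-1) (- y ^- 2 *: 1).
    by apply: (is_deriveV (f := id)); rewrite gt_eqF.
  rewrite (_ : f y = - k *: (- y ^- 2 *: 1)); first exact: is_deriveZ.
  by rewrite /f /GRing.scale /= mulr1 mulrNN.
have cf (y : R) : 0 < y -> {for y, continuous f}.
  move=> y0; apply: cvgMr; apply: cvgV; first by rewrite expf_neq0 // gt_eqF.
  exact: exprn_continuous.
have cW (y : R) : 0 < y -> {for y, continuous W}.
  by move=> y0; apply: cvgMr; apply: cvgV; [rewrite gt_eqF|exact: cvg_id].
have W0 : W y @[y --> +oo] --> (0 : R).
  rewrite -(mulr0 (- k)); apply: cvgMr; apply: (iffRL (gtr0_cvgV0 (f := id) _)); last exact: cvg_id.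
  exact: nbhs_pinfty_gt.
have cfa : {within `[a, +oo[, continuous f}.
  apply: continuous_in_subspaceT => y; rewrite inE /= in_itv /= andbT => ay.
  exact/cf/(lt_le_trans a0).
rewrite -[leRHS](_ : (\int[@lebesgue_measure R]_(y in `[a, +oo[) (f y)%:E)%E = _); last first.
  rewrite (@ge0_continuous_FTC2y _ f W a 0).
  - by rewrite /W sub0e -EFinN mulNr opprK.
  - by move=> y ay; rewrite divr_ge0 // exprn_ge0 // (le_trans _ ay) // ltW.
  - exact: cfa.
  - exact: W0.
  - by move=> y ay; exact: (@ex_derive _ _ _ _ _ _ _ (dW y (lt_trans a0 ay))).
  - exact/cvg_at_right_filter/cW.
  - move=> y; rewrite in_itv /= andbT => ay; rewrite derive1E.
    exact: (@derive_val _ _ _ _ _ _ _ (dW y (lt_trans a0 ay))).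
have mf : measurable_fun `[a, +oo[ (EFin \o f).
  apply/measurable_EFinP; apply: subspace_continuous_measurable_fun cfa.
  exact: measurable_itv.
have sub : `]a, +oo[%classic `<=` (`[a, +oo[%classic : set R).
  by move=> y /=; rewrite !in_itv /= !andbT; exact: ltW.
apply: (@le_trans _ _ (\int[@lebesgue_measure R]_(y in `]a, +oo[) (f y)%:E)%E).
  apply: ge0_le_integral => //.
  - by move=> y _; rewrite lee_fin.
  - by apply/measurable_EFinP; exact: measurable_funTS.
  - by apply: measurable_funS mf => //; exact: measurable_itv.
  - by move=> y /=; rewrite in_itv /= andbT lee_fin; exact: gk.
apply: ge0_subset_integral; [exact: measurable_itv|exact: measurable_itv|exact: mf| |exact: sub].
by move=> y _; rewrite lee_fin divr_ge0 // exprn_even_ge0.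
Qed.

Section DensityCdf.
Context {R : realType} (rho : R -> R).
Notation mu := (@lebesgue_measure R).
Hypothesis rho_density : is_density_nonneg rho.

Let D : set R := `[0, +oo[%classic.
Let rho0 : R -> R := rho \_ D.

Definition dcdf (x : R) : R := \int[mu]_(y in `]-oo, x]) rho0 y.

Let rho0_ge0 y : 0 <= rho0 y.
Proof.
case: rho_density => _ h _; rewrite /rho0 patchE; case: ifP => //.
by rewrite inE /D /= in_itv /= andbT; exact: h.
Qed.

Let rho0_int : mu.-integrable [set: R] (EFin \o rho0).
Proof.
case: rho_density => m h e; rewrite /rho0 -restrict_EFin.
have mD : measurable D by exact: measurable_itv.
apply: (iffLR (integrable_restrict mu mD measurableT _)); rewrite setTI.
apply/integrableP; split; first exact/measurable_EFinP.
have -> : (\int[mu]_(x in D) `|(EFin \o rho) x| = \int[mu]_(x in D) (rho x)%:E)%E.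
  apply: eq_integral => x.
  by rewrite inE /D /= in_itv /= andbT => x0; rewrite ger0_norm // h.
by rewrite e ltry.
Qed.

Let rho0_intS (A : set R) : measurable A -> mu.-integrable A (EFin \o rho0).
Proof. by move=> mA; apply: integrableS rho0_int. Qed.

Lemma dcdf_law (A : set R) : measurable A ->
  (\int[mu]_(x in A `&` D) (rho x)%:E)%E = (\int[mu]_(x in A) rho0 x)%:E.
Proof.
move=> mA; rewrite /Rintegral fineK; last exact: integrable_fin_num (rho0_intS mA).
by rewrite integral_mkcondr; apply: eq_integral => x _; rewrite /rho0 !patchE; case: ifP.
Qed.

Let itvB x y : x <= y -> dcdf y - dcdf x = \int[mu]_(z in `]x, y]) rho0 z.
Proof.
by move=> xy; rewrite /dcdf (@Rintegral_itvB _ rho0 -oo%O (BRight y) x) //; exact: rho0_intS.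
Qed.

Lemma dcdf_mono : {homo dcdf : x y / x <= y}.
Proof. by move=> x y xy; rewrite -subr_ge0 itvB //; exact: Rintegral_ge0. Qed.

Lemma dcdf_continuous : continuous dcdf.
Proof.
move=> x; apply/cvgrPdist_le => e e0.
have [dd [d0 hd]] := integral_normr_continuous rho0_int e0.
have key a b : a <= b -> b - a < dd -> `|dcdf b - dcdf a| <= e.
  move=> ab bad; rewrite itvB // ger0_norm; last exact: Rintegral_ge0.
  apply: ltW; rewrite (@eq_Rintegral _ _ _ mu _ (fun z => `|rho0 z|)); last first.
    by move=> z _; rewrite ger0_norm.
  apply: hd; first exact: measurable_itv.
  rewrite [ltLHS](lebesgue_measure_itv (`]a, b] : interval R)) /= lte_fin.
  by case: ifP => _; rewrite -?EFinB lte_fin.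
exists dd => //= t /= xt; have [tx|/ltW tx] := leP t x.
  by apply: key => //; rewrite ger0_norm ?subr_ge0 // in xt.
by rewrite distrC; apply: key => //; rewrite distrC ger0_norm ?subr_ge0 // in xt.
Qed.

Lemma dcdf0 : dcdf 0 = 0.
Proof.
rewrite /dcdf; apply: EFin_inj; rewrite -dcdf_law; last exact: measurable_itv.
rewrite (_ : _ `&` _ = [set 0]) ?integral_set1 //.
apply/seteqP; split => x /=; rewrite /D /= !in_itv /= ?andbT.
  by move=> [x0 y0]; apply/eqP; rewrite eq_le x0.
by move=> ->; rewrite lexx.
Qed.

Section NearZero.
Variable d : R.
Hypothesis d_gt1 : 1 < d.
Hypothesis rho_near0 : rho x / (d * x `^ (d - 1)) @[x --> 0^'+] --> (1 : R).

Let p (y : R) : R := d * `|y| `^ (d - 1).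

Let p_continuous : continuous p.
Proof.
by move=> y; apply: cvgMr; apply: abs_powR_continuous; rewrite subr_gt0.
Qed.

Let scaled_int k x : mu.-integrable `]0, x] (EFin \o (fun y => k * p y)).
Proof.
apply: (@integrableS _ _ _ mu `[0, x]); try exact: measurable_itv.
  by move=> y /=; exact: subset_itv_oc_cc.
by apply: continuous_integrable => y; apply: cvgMr; exact: p_continuous.
Qed.

Let p_int x : mu.-integrable `]0, x] (EFin \o p).
Proof.
by have := scaled_int 1 x; rewrite (_ : (fun y => 1 * p y) = p) //; apply/funext => y; rewrite mul1r.
Qed.

Let prim_p x : 0 <= x -> \int[mu]_(y in `]0, x]) p y = x `^ d.
Proof.
move=> x0; have d0 : 0 < d := lt_trans ltr01 d_gt1.
rewrite Rintegral_itv_obnd_cbnd; last exact: p_int.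
rewrite -[LHS]/(prim p x).
have dW (y : R) : 0 < y -> is_derive y 1 (fun y => y `^ d) (p y).
  by move=> y0; rewrite /p gtr0_norm //; exact: is_derive1_powR.
have W0 : y `^ d @[y --> 0^'+] --> (0 : R) `^ d by rewrite powR0 ?gt_eqF //; exact: powR_cvg0.
by rewrite (primE_gt0 p_continuous dW W0 x0) powR0 ?gt_eqF // subr0.
Qed.

(** Integrate the comparison of [rho] with [d y^(d-1)], whose antiderivative is
    [y^d]. *)
Lemma dcdf_near0 (eps : R) : 0 < eps -> exists2 delta, 0 < delta &
  forall x, 0 <= x -> x <= delta ->
    (1 - eps) * x `^ d <= dcdf x /\ dcdf x <= (1 + eps) * x `^ d.
Proof.
move=> e0; have d0 : 0 < d := lt_trans ltr01 d_gt1.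
have /cvgrPdist_le/(_ _ e0)[delta /= delta0 h] := rho_near0.
exists (delta / 2); first by rewrite divr_gt0.
move=> x x0 xd.
have bnd y : 0 < y -> y <= x -> (1 - eps) * p y <= rho0 y /\ rho0 y <= (1 + eps) * p y.
  move=> y0 yx.
  have yd : y < delta by apply: le_lt_trans yx (le_lt_trans xd _); rewrite ltr_pdivrMr // ltr_pMr // ltr1n.
  have py0 : 0 < p y by rewrite mulr_gt0 // powR_gt0 // normr_gt0 gt_eqF.
  have -> : rho0 y = rho y / p y * p y.
    by rewrite divfK ?gt_eqF // /rho0 patchE mem_set // /D /= in_itv /= (ltW y0).
  rewrite !ler_pM2r //.
  have /= := h y; rewrite sub0r normrN gtr0_norm // => /(_ yd y0).
  by rewrite ler_distlC /p gtr0_norm // => /andP[? ?]; split; lra.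
have pE k : k * x `^ d = \int[mu]_(y in `]0, x]) (k * p y).
  by rewrite -prim_p // RintegralZl //; exact: p_int.
rewrite -[dcdf x]subr0 -dcdf0 itvB // !pE; split; apply: le_Rintegral => //; try exact: rho0_intS;
  by move=> y /=; rewrite in_itv /= => /andP[y0 yx]; case: (bnd y y0 yx).
Qed.

End NearZero.


Let tailE x : 1 - dcdf x = \int[mu]_(y in `]x, +oo[) rho0 y.
Proof.
have <- : \int[mu]_(y in `]-oo, +oo[) rho0 y = 1.
  apply: EFin_inj; rewrite -dcdf_law; last exact: measurable_itv.
  by case: rho_density => _ _ <-; rewrite set_itvNyy setTI.
rewrite /dcdf (@Rintegral_itvB _ rho0 -oo%O +oo%O x) //.
exact: rho0_intS.
Qed.

(** Chebyshev's inequality, with [y^2 <= 1 + y^r] for the second moment. *)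
Lemma dcdf_tail (r : R) : 2 <= r ->
  (\int[mu]_(x in `[0%R, +oo[) (x `^ r * rho x)%:E < +oo)%E ->
  exists2 M, 0 <= M & forall x, 0 < x -> 1 - dcdf x <= M / x ^+ 2.
Proof.
move=> r2 mom; have [mr h tot] := rho_density.
have mD : measurable D := measurable_itv _.
have Dge y : D y -> 0 <= y by rewrite /D /= in_itv /= andbT.
have p0 y : D y -> 0 <= y `^ r * rho y by move=> /Dge y0; rewrite mulr_ge0 ?powR_ge0 ?h.
set m := (\int[mu]_(x in _) _)%E in mom.
have m0 : (0 <= m)%E by apply: integral_ge0 => y Dy; rewrite lee_fin; exact: p0.
have mfin : m \is a fin_num by rewrite ge0_fin_numE.
exists (1 + fine m); first by rewrite addr_ge0 ?fine_ge0.
move=> x x0; rewrite ler_pdivlMr ?exprn_gt0 // tailE -lee_fin EFinM -dcdf_law; last exact: measurable_itv.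
rewrite EFinD fineK // muleC.
have mA : measurable (`]x, +oo[ `&` D) by apply: measurableI => //; exact: measurable_itv.
have mrE : measurable_fun D (fun y => (rho y)%:E) by exact/measurable_EFinP.
have mp : measurable_fun D (fun y => (y `^ r * rho y)%:E).
  apply/measurable_EFinP/measurable_funM => //.
  by apply: measurable_funTS; exact: measurable_powR.
have hE y : D y -> (0 <= (rho y)%:E)%E by move=> /Dge /h.
have pE y : D y -> (0 <= (y `^ r * rho y)%:E)%E by move=> /p0.
rewrite -tot /m -ge0_integralD // -ge0_integralZl_EFin //; first last.
- by rewrite exprn_ge0 // ltW.
- by apply: measurable_funS mrE.
- by move=> y [_ /hE].
apply: (@le_trans _ _ (\int[mu]_(y in `]x, +oo[ `&` D) ((rho y)%:E + (y `^ r * rho y)%:E)%E)%E).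
  apply: ge0_le_integral => //.
  - by move=> y [_ /hE]; rewrite !lee_fin => rp; rewrite mulr_ge0 // exprn_ge0 // ltW.
  - by apply: emeasurable_funM => //; apply: measurable_funS mrE.
  - by apply: emeasurable_funD; [apply: measurable_funS mrE|apply: measurable_funS mp].
  move=> y [] /=; rewrite in_itv /= andbT => xy /hE; rewrite !lee_fin => rp.
  have y0 : 0 < y := lt_trans x0 xy.
  rewrite -{2}[rho y]mul1r -mulrDl ler_wpM2r //.
  apply: (@le_trans _ _ (y ^+ 2)); first by rewrite ler_pXn2r ?nnegrE ?ltW.
  have [y1|/ltW y1] := leP y 1.
    by apply: ler_wpDr; rewrite ?powR_ge0 // expr_le1 // ltW.
  by apply: ler_wpDl => //; rewrite -powR_mulrn ?(ltW y0) // ler_powR.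
apply: ge0_subset_integral => //; first exact: emeasurable_funD.
by move=> y Dy; rewrite adde_ge0 // ?hE ?pE.
Qed.

Lemma cdf_density disp (T : measurableType disp) (P : probability T R) (X : {RV P >-> R}) x :
  has_density_nonneg P X rho -> fine (P [set t | X t <= x]) = dcdf x.
Proof.
move=> /(_ `]-oo, x]%classic (measurable_itv _)).
rewrite dcdf_law; last exact: measurable_itv.
rewrite /distribution /pushforward (_ : _ @^-1` _ = [set t | X t <= x]) => [->//|].
by apply/seteqP; split => t /=; rewrite in_itv.
Qed.

End DensityCdf.
(** * Convergence of the rescaled cost *)
Section CostClose.
Context disp {T : measurableType disp} {R : realType} (P : probability T R).
Context {n : nat} (X : edge n -> {RV P >-> R}) (F : R -> R) (d : R).
Hypothesis indep : mutually_independent P X.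
Hypothesis cdfX : forall e x, fine (P [set t | X e t <= x]) = F x.
Hypothesis cF : continuous F.
Hypothesis F_mono : {homo F : x y / x <= y}.
Hypothesis F0 : F 0 = 0.
Hypothesis n_gt0 : (0 < n)%N.
Hypothesis d_gt1 : 1 < d.

Let c (x : R) : R := n%:R * (1 + n%:R * `|x| `^ d)^-1.

Let n0 : 0 < n%:R :> R. Proof. by rewrite ltr0n. Qed.

Let den_gt0 (x : R) : 0 < 1 + n%:R * `|x| `^ d.
Proof. by rewrite ltr_pwDl // mulr_ge0 ?powR_ge0 // ltW. Qed.

Let c_gt0 (x : R) : 0 < c x. Proof. by rewrite mulr_gt0 ?invr_gt0. Qed.

Let cc : continuous c.
Proof.
move=> x; apply: cvgMr; apply: cvgV; first by rewrite gt_eqF.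
apply: cvgD; first exact: cvg_cst.
by apply: cvgMr; apply: abs_powR_continuous; exact: lt_trans d_gt1.
Qed.

Let cV (x : R) : 0 <= x -> (c x)^-1 = n%:R^-1 + x `^ d.
Proof.
move=> x0; rewrite /c invfM invrK ger0_norm // mulrDr mulr1 mulrA mulVf ?mul1r //.
by rewrite gt_eqF.
Qed.

(** [1 / c x] is [1/n + x^d]; the hypotheses compare [x^d] with the two
    quantities that [mean_free_upper] and [mean_inv_upper] add to about [1/n]. *)
Lemma free_near_hill th x0 x : 0 < th -> th ^+ 2 <= 1 / 2 -> F x0 < 1 -> 0 <= x -> x <= x0 ->
  (1 - th ^+ 2) * x `^ d <= F x -> F x / (1 - F x0) <= (1 + th ^+ 2) * x `^ d ->
  Ex P (fun t => `|(nfree (fun e => X e t) x)%:R - c x|) <= 1 + (th + th^-1 + 5 * th * c x) / 2.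
Proof.
move=> th0 th2 Fx0 x_ge0 xx0 lo hi.
have Fx1 : F x < 1 := le_lt_trans (F_mono xx0) Fx0.
have cVE := cV x_ge0; have cVp : 0 < (c x)^-1 by rewrite invr_gt0.
have ni : 0 < n%:R^-1 :> R by rewrite invr_gt0.
set e := th ^+ 2 in th2 lo hi *.
have e0 : 0 < e by rewrite exprn_gt0.
apply: mean_dist => //.
  apply: le_trans (mean_free_upper indep cdfX cF F_mono F0 n_gt0 x_ge0 Fx1) _.
  have hp : 0 < (1 - e) * (c x)^-1 by rewrite mulr_gt0 //; lra.
  have h1 : (1 - e) * (c x)^-1 <= n%:R^-1 + F x.
    rewrite cVE mulrDr lerD // ler_piMl ?(ltW ni) //; lra.
  apply: le_trans (_ : ((1 - e) * (c x)^-1)^-1 <= _); first by rewrite lef_pV2 // posrE // (lt_le_trans hp).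
  have e1 : 0 < 1 - e by lra.
  by rewrite -/e invfM invrK mulrC ler_pM2l // -[leLHS]mul1r ler_pdivrMr //; nra.
apply: le_trans (mean_inv_upper indep cdfX cF F_mono F0 x_ge0 xx0 Fx0) _.
rewrite cVE mulrDr lerD // -[leLHS]mul1r.
have h : n.+1%:R^-1 <= n%:R^-1 :> R by rewrite lef_pV2 ?posrE // ler_nat.
by apply: le_trans (_ : 1 * n%:R^-1 <= _); [rewrite !mul1r|rewrite ler_pM2r // lerDl ltW].
Qed.

(** The error of [free_near_hill] is integrated up to [x0]; beyond [x0], the mean
    is at most [1 / F x0] times the tail of the costs, uniformly in [n]. *)
Lemma cost_near_hill th x0 M : 0 < th -> th ^+ 2 <= 1 / 2 -> 0 < x0 -> 0 < F x0 -> F x0 < 1 ->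
  (forall x, 0 <= x -> x <= x0 -> (1 - th ^+ 2) * x `^ d <= F x) ->
  (forall x, 0 <= x -> x <= x0 -> F x / (1 - F x0) <= (1 + th ^+ 2) * x `^ d) ->
  0 <= M -> (forall x, 0 < x -> 1 - F x <= M / x ^+ 2) ->
  (\int[P]_t (`|stable_cost (fun e => X e t) - prim c x0|)%:E <=
   (x0 * (1 + (th + th^-1) / 2) + 5 * th / 2 * prim c x0
    + (F x0)^-1 / (1 - F x0) * M / x0)%:E)%E.
Proof.
move=> th0 th2 x00 Fx0 Fx1 lo hi M0 tail.
pose B x := (1 + (th + th^-1) / 2) + 5 * th / 2 * c x.
have cB : continuous B.
  by move=> x; apply: cvgD; [exact: cvg_cst|apply: cvgMr; exact: cc].
have -> : x0 * (1 + (th + th^-1) / 2) + 5 * th / 2 * prim c x0 = prim B x0.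
  rewrite primD; [|by move=> ?; exact: cvg_cst|by move=> ?; apply: cvgMr; exact: cc].
  rewrite (primZ _ _ cc); congr (_ + _); rewrite [RHS]Rintegral_cst; last exact: measurable_itv.
  rewrite mulrC; congr (_ * _).
  rewrite [X in fine X](lebesgue_measure_itv (`[0, x0]%R : interval R)) /= lte_fin x00.
  by rewrite oppr0 addr0.
apply: cost_L1 => //.
- exact: ae_generic indep cdfX cF F_mono F0.
- by move=> x; exact: ltW.
- move=> x /andP[x_ge0 xx0].
  apply: le_trans (free_near_hill th0 th2 Fx1 x_ge0 xx0 (lo _ x_ge0 xx0) (hi _ x_ge0 xx0)) _.
  by rewrite /B; lra.
pose k := (F x0)^-1 / (1 - F x0) * M.
have F1 : 0 < 1 - F x0 by rewrite subr_gt0.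
have k0 : 0 <= k by rewrite !mulr_ge0 // invr_ge0 ltW.
apply: integral_le_inv_sqr => //.
- apply: nonincreasing_measurable => // x y; exact: mean_free_mono.
- by move=> x; exact: mean_free_ge0.
move=> y x0y; have y0 := lt_trans x00 x0y.
apply: le_trans (mean_free_tail indep cdfX cF F_mono n_gt0 (ltW x00) (ltW x0y) Fx1) _.
rewrite /k -[leRHS]mulrA; apply: ler_pM.
- by rewrite divr_ge0 ?mean_free_ge0 // ltW.
- by rewrite -(Ex_gt cdfX (Ordinal n_gt0, Ordinal n_gt0)); exact: Ex_ge0.
- rewrite ler_pM2r ?invr_gt0 //.
  apply: le_trans (mean_free_upper indep cdfX cF F_mono F0 n_gt0 (ltW x00) Fx1) _.
  by rewrite lef_pV2 ?posrE // ?addr_gt0 ?invr_gt0 // lerDr invr_ge0 ltW.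
exact: tail.
Qed.

End CostClose.

Section Choice.
Context {R : realType} (rho : R -> R) (d : R).
Hypothesis rho_density : is_density_nonneg rho.
Hypothesis d_gt1 : 1 < d.
Hypothesis rho_near0 : rho x / (d * x `^ (d - 1)) @[x --> 0^'+] --> (1 : R).
Let F := dcdf rho.

(** The factor [1 / (1 - F x0)] is close to 1 for small [x0], as [F] is continuous
    at 0. *)
Lemma hill_window e : 0 < e -> e <= 1 / 2 -> exists x0, [/\ 0 < x0, 0 < F x0, F x0 < 1,
  forall x, 0 <= x -> x <= x0 -> (1 - e) * x `^ d <= F x &
  forall x, 0 <= x -> x <= x0 -> F x / (1 - F x0) <= (1 + e) * x `^ d].
Proof.
move=> e0 e2; have e40 : 0 < e / 4 by lra.
have [delta delta0 h] := dcdf_near0 rho_density d_gt1 rho_near0 e40.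
have /cvgrPdist_le/(_ _ e40)[r /= r0 hr] := @dcdf_continuous _ _ rho_density 0.
pose x0 := Num.min delta (r / 2).
have x00 : 0 < x0 by rewrite lt_min delta0 divr_gt0.
have x0d : x0 <= delta by rewrite ge_min lexx.
have pw : 0 < x0 `^ d by rewrite powR_gt0.
have [lo0 hi0] := h _ (ltW x00) x0d.
have Fx0 : 0 < F x0 by apply: lt_le_trans lo0; rewrite mulr_gt0 //; lra.
have Fx4 : F x0 <= e / 4.
  have := hr x0; rewrite /= sub0r normrN gtr0_norm // => /(_ _).
  rewrite dcdf0 // sub0r normrN gtr0_norm //; apply.
  by rewrite gt_min; apply/orP; right; rewrite ltr_pdivrMr // ltr_pMr // ltr1n.
exists x0; split => //; first by lra.
  move=> x x_ge0 xx0; have [lo _] := h _ x_ge0 (le_trans xx0 x0d).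
  by apply: le_trans lo; rewrite ler_wpM2r ?powR_ge0 //; lra.
move=> x x_ge0 xx0; have [_ hi] := h _ x_ge0 (le_trans xx0 x0d).
rewrite ler_pdivrMr ?subr_gt0; last by lra.
apply: le_trans hi _; rewrite mulrAC ler_wpM2r ?powR_ge0 //; nra.
Qed.

End Choice.

Lemma powR_nat_large {R : realType} (p A : R) : 0 < p -> \forall n \near \oo, A <= n%:R `^ p.
Proof.
move=> p0; near=> n.
apply: (le_trans (ler_norm A)).
have -> : `|A| = (`|A| `^ p^-1) `^ p by rewrite -powRrM mulVf ?gt_eqF // powRr1.
apply: (ge0_ler_powR (ltW p0)); rewrite ?nnegrE ?powR_ge0 //.
near: n; exact: nbhs_infty_ger.
Unshelve. all: by end_near.
Qed.

Section Rescaling.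
Context disp {T : measurableType disp} {R : realType} (P : probability T R) (C : T -> R).
Hypothesis mC : measurable_fun [set: T] C.

Let integral_const (k : R) : (\int[P]_t k%:E)%E = k%:E.
Proof. by rewrite integral_cst // -[RHS]mule1; congr (_ * _)%E; exact: probability_setT. Qed.

Lemma L1_rescale (I s L a : R) : 0 < s ->
  (\int[P]_t (`|C t - I|)%:E <= a%:E)%E ->
  (\int[P]_t (`|C t / s - L|)%:E <= (a / s + `|I / s - L|)%:E)%E.
Proof.
move=> s0 h.
have mCI : measurable_fun [set: T] (fun t => `|C t - I|).
  by apply: measurableT_comp => //; exact: measurable_funB.
have si : 0 <= s^-1 by rewrite invr_ge0 ltW.
apply: (@le_trans _ _ (\int[P]_t ((s^-1)%:E * (`|C t - I|)%:E + (`|I / s - L|)%:E))%E).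
  apply: ge0_le_integral => //.
  - apply/measurable_EFinP; apply: measurableT_comp => //; apply: measurable_funB => //.
    exact: measurable_funM.
  - apply/measurable_EFinP; apply: measurable_funD => //.
    exact: measurable_funM.
  - move=> t _; rewrite -EFinM -EFinD lee_fin.
    have -> : s^-1 * `|C t - I| = `|s^-1 * (C t - I)| by rewrite normrM (ger0_norm si).
    apply: le_trans (ler_normD _ _).
    by rewrite (_ : C t / s - L = s^-1 * (C t - I) + (I / s - L)) //; ring.
rewrite ge0_integralD //; last 2 first.
- by move=> t _; rewrite mule_ge0 ?lee_fin.
- by apply/measurable_EFinP/measurable_funM.
rewrite integral_const ge0_integralZl_EFin //; last first.
  exact/measurable_EFinP.
rewrite EFinD leeD2r // [X in (_ <= X)%E](_ : _ = (s^-1)%:E * a%:E)%E.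
  by rewrite lee_wpmul2l ?lee_fin.
by rewrite -EFinM mulrC.
Qed.

Lemma mean_close (s L a : R) : 0 < s ->
  (\int[P]_t (`|C t / s - L|)%:E <= a%:E)%E ->
  exists2 m, ('E_P[C] / s%:E = m%:E)%E & `|m - L| <= a.
Proof.
move=> s0 h.
have mCs : measurable_fun [set: T] (fun t => C t / s) by exact: measurable_funM.
have iD : P.-integrable [set: T] (fun t => (C t / s - L)%:E).
  apply/integrableP; split; first exact/measurable_EFinP/measurable_funB.
  by apply: le_lt_trans h (ltry _).
have D_fin := integrable_fin_num measurableT iD.
set D := (\int[P]_t (C t / s - L)%:E)%E in D_fin.
exists (fine D + L); last first.
  rewrite addrK -lee_fin -[(`|fine D|)%:E]/(`|(fine D)%:E|%E) fineK //.
  exact: le_trans (le_abse_integral P measurableT (measurable_int _ iD)) h.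
have -> : ('E_P[C] = s%:E * (fine D + L)%:E)%E.
  rewrite unlock (_ : (fun t => (C t)%:E) = (fun t => s%:E * (C t / s - L)%:E + (s * L)%:E)%E); last first.
    apply/funext => t; rewrite -EFinM -EFinD mulrBr subrK mulrC divfK // gt_eqF //.
  rewrite integralD //=; last 2 first.
  - exact: integrableZl.
  - exact: finite_measure_integrable_cst.
  by rewrite integralZl // integral_const -/D -[X in (_ * X)%E]fineK // -!EFinM -EFinD mulrDr.
by rewrite inver gt_eqF // -!EFinM mulrAC mulfV ?mul1r // gt_eqF.
Qed.

Lemma prob_close (s L a eps : R) : 0 < eps ->
  (\int[P]_t (`|C t / s - L|)%:E <= a%:E)%E ->
  (P [set t | (eps < `|C t / s - L|)%R] <= (a / eps)%:E)%E.
Proof.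
move=> e0 h.
have mg : measurable_fun [set: T] (fun t => C t / s - L).
  by apply: measurable_funB => //; exact: measurable_funM.
have mgn : measurable_fun [set: T] (fun t => `|C t / s - L|) by exact: measurableT_comp.
have mA : measurable [set t | eps < `|C t / s - L|%R].
  rewrite (_ : [set t | _] = (fun t => `|C t / s - L|) @^-1` `]eps, +oo[).
    by rewrite -[X in measurable X]setTI; exact: mgn.
  by apply/seteqP; split=> t; rewrite /= in_itv /= andbT.
have mG (B : set T) : measurable B -> measurable_fun B (fun t => (`|C t / s - L|)%:E).
  by move=> mB; apply/measurable_EFinP; apply: measurable_funTS.
have : (eps%:E * P [set t | (eps < `|C t / s - L|)%R] <= a%:E)%E.
  rewrite -integral_cst //; apply: le_trans h.
  apply: (@le_trans _ _ (\int[P]_(t in [set t | (eps < `|C t / s - L|)%R]) (`|C t / s - L|)%:E)%E).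
    apply: ge0_le_integral => //; try exact: mG.
    - by move=> t _; rewrite lee_fin ltW.
    - by move=> t /= et; rewrite lee_fin ltW.
  by apply: ge0_subset_integral => //; exact: mG.
by rewrite mulrC EFinM -lee_pdivrMl ?invr_gt0 // invrK.
Qed.

End Rescaling.

Section L1Convergence.
Context {R : realType} (d r : R) (rho : R -> R)
  (disp : nat -> measure_display) (T : forall n, measurableType (disp n))
  (P : forall n, probability (T n) R) (X : forall n, edge n -> {RV (P n) >-> R}).
Arguments X : clear implicits.
Hypotheses (d_gt1 : 1 < d) (rho_density : is_density_nonneg rho)
  (rho_near0 : rho x / (d * x `^ (d - 1)) @[x --> 0^'+] --> (1 : R))
  (r_gt : 2 * d / (d - 1) < r)
  (rho_moment : (\int[lebesgue_measure]_(x in `[0%R, +oo[) (x `^ r * rho x)%:E < +oo)%E)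
  (indep : forall n, mutually_independent (P n) (X n))
  (density : forall n e, has_density_nonneg (P n) (X n e) rho).

Let L : R := pi / (d * sin (pi / d)).
Let J (x : R) : R := prim (hill d) x.

(** In the bound of [cost_near_hill] only the term with [th] is of the order of
    the normalisation, and it carries the small factor [th]; the other terms are
    constants. *)
Lemma stable_cost_L1 (eta : R) : 0 < eta -> \forall n \near \oo,
  (\int[P n]_t (`|stable_cost (fun e => X n e t) / n%:R `^ (1 - d^-1) - L|)%:E <= eta%:E)%E.
Proof.
move=> eta0; have d0 : 0 < d := lt_trans ltr01 d_gt1.
have r2 : 2 <= r.
  apply/ltW/(le_lt_trans _ r_gt); rewrite ler_pdivlMr ?subr_gt0 //; lra.
have [M M0 tail] := dcdf_tail rho_density r2 rho_moment.
have L1 : 0 < 5 * (`|L| + 1) by rewrite mulr_gt0 // ltr_wpDl.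
(* [5 th / 2] times the rescaled integral, at most [`|L| + 1], will be at most [eta / 2] *)
pose th := Num.min (1 / 2) (eta / (5 * (`|L| + 1))).
have th0 : 0 < th by rewrite lt_min divr_gt0 //= divr_gt0.
have th12 : th <= 1 / 2 by rewrite ge_min lexx.
have thL : th * (5 * (`|L| + 1)) <= eta by rewrite -ler_pdivlMr // ge_min lexx orbT.
have th2 : th ^+ 2 <= 1 / 2 by rewrite expr2; nra.
have e0 : 0 < th ^+ 2 by rewrite exprn_gt0.
have [x0 [x00 Fx0 Fx1 lo hi]] := hill_window rho_density d_gt1 rho_near0 e0 th2.
pose F := dcdf rho.
pose K := x0 * (1 + (th + th^-1) / 2) + (F x0)^-1 / (1 - F x0) * M / x0.
pose m := Num.min 1 (eta / 4).
have m0 : 0 < m by rewrite lt_min ltr01 divr_gt0.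
have m1 : m <= 1 by rewrite ge_min lexx.
have m4 : m <= eta / 4 by rewrite ge_min lexx orbT.
have d1 : 0 < 1 - d^-1 by rewrite subr_gt0 invf_lt1.
have di : 0 < d^-1 by rewrite invr_gt0.
have [A [_ hA]] : \forall x \near +oo, `|J x - L| <= m.
  have /cvgrPdist_le/(_ _ m0) := prim_hill_cvg d_gt1.
  by apply: filterS => x; rewrite distrC.
have big1 := powR_nat_large (K / (eta / 4)) d1.
have big2 := powR_nat_large ((A + 1) / x0) di.
near=> n.
have n_gt0 : (0 < n)%N by near: n; exact: nbhs_infty_gt.
have n0 : n%:R != 0 :> R by rewrite pnatr_eq0 -lt0n.
set b : R := n%:R `^ d^-1; set s : R := n%:R `^ (1 - d^-1).
have b0 : 0 < b by rewrite powR_gt0 // ltr0n.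
have s0 : 0 < s by rewrite powR_gt0 // ltr0n.
have bd : b `^ d = n%:R by rewrite /b -powRrM mulVf ?gt_eqF // powRr1.
have sE : s = n%:R / b by rewrite /s powRB ?n0 ?implybT // powRr1.
have cdfX e x : fine (P n [set t | X n e t <= x]) = F x by exact: cdf_density.
have close := cost_near_hill (@indep n) cdfX (dcdf_continuous rho_density)
  (dcdf_mono rho_density) (dcdf0 rho_density) n_gt0 d_gt1 th0 th2 x00 Fx0 Fx1 lo hi M0 tail.
apply: le_trans (L1_rescale (measurable_stable_cost _) L s0 close) _.
rewrite (prim_hill_scale d_gt1 b0 bd (ltW x00)) -sE -/(J _).
have Jb : `|J (b * x0) - L| <= m.
  apply: hA; rewrite -ltr_pdivrMr //.
  apply: (@lt_le_trans _ _ ((A + 1) / x0)); first by rewrite ltr_pM2r ?invr_gt0 // ltrDl.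
  by rewrite /b; near: n.
have Ks : K / s <= eta / 4.
  rewrite ler_pdivrMr // mulrC -ler_pdivrMr ?divr_gt0 //.
  by rewrite /s; near: n.
rewrite lee_fin [s * _]mulrC mulfK ?gt_eqF //.
have Js : J (b * x0) <= `|L| + 1.
  have : J (b * x0) - L <= 1 := le_trans (ler_norm _) (le_trans Jb m1).
  have := ler_norm L; lra.
have -> : (x0 * (1 + (th + th^-1) / 2) + 5 * th / 2 * (J (b * x0) * s)
    + (F x0)^-1 / (1 - F x0) * M / x0) / s = K / s + 5 * th / 2 * J (b * x0).
  by rewrite /K; field; rewrite !gt_eqF // subr_gt0.
have : 5 * th * J (b * x0) <= eta.
  by apply: le_trans thL; rewrite [5 * th]mulrC -mulrA !ler_pM2l.
move: Ks Jb; set k := K / s; set j := J _; set v := `|_|; lra.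
Unshelve. all: by end_near.
Qed.

End L1Convergence.
Theorem theorem1p2 (R : realType) (d r : R) (rho : R -> R)
    (disp : nat -> measure_display) (T : forall n, measurableType (disp n))
    (P : forall n, probability (T n) R)
    (omega : forall n, edge n -> {RV (P n) >-> R})
    (d_gt1 : 1 < d)
    (rho_density : is_density_nonneg rho)
    (rho_near0 : rho x / (d * x `^ (d - 1)) @[x --> 0^'+] --> (1 : R))
    (r_gt : 2 * d / (d - 1) < r)
    (rho_moment :
      (\int[lebesgue_measure]_(x in `[0%R, +oo[) (x `^ r * rho x)%:E < +oo)%E)
    (omega_indep : forall n, mutually_independent (P n) (omega n))
    (omega_density : forall n e, has_density_nonneg (P n) (omega n e) rho) :
  let C n (t : T n) : R := stable_cost (fun e => omega n e t) in
  let L : R := pi / (d * sin (pi / d)) in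
  ('E_(P n)[C n] / (n%:R `^ (1 - d^-1))%:E)%E @[n --> \oo] --> L%:E /\
  cvg_in_probability P (fun n t => C n t / n%:R `^ (1 - d^-1)) L.
Proof.
move=> C L.
have close := stable_cost_L1 d_gt1 rho_density rho_near0 r_gt rho_moment
  omega_indep omega_density.
have mC n : measurable_fun [set: T n] (C n) := measurable_stable_cost (omega n).
have mean eta : 0 < eta -> \forall n \near \oo,
    exists2 m, ('E_(P n)[C n] / (n%:R `^ (1 - d^-1))%:E = m%:E)%E & `|m - L| <= eta.
  move=> eta0; near=> n; apply: mean_close.
  - exact: mC.
  - by rewrite powR_gt0 // ltr0n; near: n; exact: nbhs_infty_gt.
  - by near: n; exact: close.
split.
  apply/fine_cvgP; split.
    by apply: filterS (mean 1 ltr01) => n [m -> _].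
  apply/cvgrPdist_le => eta eta0.
  by apply: filterS (mean eta eta0) => n [m /= -> h]; rewrite distrC.
move=> eps eps0; set Q := fun n => P n _.
have small eta : 0 < eta -> \forall n \near \oo, (Q n <= eta%:E)%E.
  move=> eta0; apply: filterS (close _ (mulr_gt0 eta0 eps0)) => n.
  by move/(prob_close (mC n) eps0); rewrite mulfK // gt_eqF.
have Q0 n : (0 <= Q n)%E by exact: measure_ge0.
have Qfin n eta : (Q n <= eta%:E)%E -> Q n \is a fin_num.
  by move=> h; rewrite ge0_fin_numE // (le_lt_trans h) // ltry.
apply/fine_cvgP; split; first by apply: filterS (small 1 ltr01) => n; exact: Qfin.
apply/cvgrPdist_le => eta eta0; apply: filterS (small eta eta0) => n /= h.
by rewrite sub0r normrN ger0_norm ?fine_ge0 // -lee_fin fineK // (Qfin _ _ h).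
Unshelve. all: by end_near.
Qed.
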